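(* Let $k\ge1$ and let $\mathfrak a_k$ be the two-sort species of $k$-trees. With $Z^{\mathfrak S_k}_{\mathcal{CT}^Y_k}$ the $\mathfrak S_k$-cycle index of $\mathcal{CT}_k^Y$ and $Z^{\mathfrak S_{k+1}}_{\mathcal{CT}^{XY}_k}$, $Z^{\mathfrak S_{k}}_{\mathcal{CT}^{XY}_k}$ the cycle indices of $\mathcal{CT}_k^{XY}$ as an $\mathfrak S_{k+1}$-species and as an $\mathfrak S_k$-species, the cycle index of $\mathfrak a_k$ is $$Z_{\mathfrak a_k}=\frac1{(k+1)!}\sum_{\sigma\in\mathfrak S_{k+1}}Z^{\mathfrak S_{k+1}}_{\mathcal{CT}^{XY}_k}(\sigma)+\frac1{k!}\sum_{\sigma\in\mathfrak S_k}Z^{\mathfrak S_k}_{\mathcal{CT}^{Y}_k}(\sigma)-\frac1{k!}\sum_{\sigma\in\mathfrak S_k}Z^{\mathfrak S_k}_{\mathcal{CT}^{XY}_k}(\sigma).$$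
   Context: **$k$-trees.** The complete graph $K_k$ is a $k$-tree, and any graph formed from a $k$-tree by adding one new vertex and joining it by edges to all vertices of some existing $k$-clique is a $k$-tree. A hedron of a $k$-tree is a $(k+1)$-clique; a front is a $k$-clique. $\mathfrak a_k$ is the two-sort species whose structures are $k$-trees with hedra labeled by sort $X$ and fronts labeled by sort $Y$ (vertices are not labeled: two labeled $k$-trees are identified if there is a graph isomorphism preserving the labels of hedra and fronts). **$k$-coding trees.** A $k$-coding tree is a finite tree with vertices colored black and white, each edge joining a black and a white vertex, in which every black vertex has exactly $k+1$ (white) neighbors and carries a cyclic ordering of them (white vertices may have any number of black neighbors; a single white vertex is allowed). $\mathcal{CT}_k$ is the two-sort species of $k$-coding trees with black vertices labeled by sort $X$ and white vertices by sort $Y$. $\mathcal{CT}_k^Y$ and $\mathcal{CT}_k^{XY}$ are the species of $k$-coding trees rooted at a white vertex and at an edge. **Actions.** $\mathfrak S_m$ is the symmetric group on $[m]=\{1,\dots,m\}$ and $\mathfrak S_k\subset\mathfrak S_{k+1}$ is the subgroup fixing $k+1$. For $\sigma\in\mathfrak S_{k+1}$, $i\in[k+1]$, let $\rho_i(\sigma)\in\mathfrak S_{k+1}$ be $a\mapsto\sigma(i+a)-\sigma(i)$, with sums and differences reduced modulo $k+1$ to representatives in $\{1,\dots,k+1\}$; $\rho_i(\sigma)$ fixes $k+1$. In a $\mathcal{CT}^Y_k$-structure, the cyclic order at each black vertex is linearized by putting its parent (the neighbor toward the root) last, in position $k+1$. Thus a $\mathcal{CT}_k^Y$-structure is a root label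 $y$ together with a set of structures $(x;W_1,\dots,W_k)$, with $x$ a black label and the $W_i$ $\mathcal{CT}_k^Y$-structures. Recursively, $\sigma\in\mathfrak S_k$ acts on a $\mathcal{CT}_k^Y$-structure by fixing $y$ and replacing each $(x;W_1,\dots,W_k)$ by $(x;W'_1,\dots,W'_k)$ with $W'_{\sigma(i)}=\rho_i(\sigma)\cdot W_i$. A $\mathcal{CT}^{XY}_k$-structure is written $(x;W_1,\dots,W_{k+1})$ with $x$ the root black vertex, the $W_i$ $\mathcal{CT}_k^Y$-structures and the white vertex of the root edge being the root of $W_{k+1}$; $\sigma\in\mathfrak S_{k+1}$ sends it to $(x;W'_1,\dots,W'_{k+1})$ with $W'_{\sigma(i)}=\rho_i(\sigma)\cdot W_i$. The $\mathfrak S_k$-action on $\mathcal{CT}^{XY}_k$ is the restriction of this action to $\mathfrak S_k$. All these actions commute with relabeling. **Cycle indices.** For a two-sort species $F$ with an action of a group $\Gamma$ commuting with relabelings (a $\Gamma$-species) and $\gamma\in\Gamma$, $$Z^\Gamma_F(\gamma)=\sum_{m,n\ge0}\frac1{m!\,n!}\sum_{\mu\in\mathfrak S_m,\nu\in\mathfrak S_n}\left|\mathrm{Fix}(\gamma\cdot F[\mu,\nu])\right|p_\mu[x]\,p_\nu[y],$$ with $p_\mu[x]=\prod_i p_i[x]^{\mu_i}$, $\mu_i$ the number of $i$-cycles of $\mu$ (similarly for $y$). The ordinary cycle index $Z_F$ is the case of trivial $\Gamma$. *)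

(* Defs.v *)
From HB Require Import structures.
From mathcomp Require Import all_boot all_order all_algebra all_fingroup.
From mathcomp Require Import finmap multiset.
From mathcomp Require Import boolp classical_sets functions cardinality.
Set Implicit Arguments.
Unset Strict Implicit.
Unset Printing Implicit Defensive.
Import GRing.Theory.
Local Open Scope mset_scope.
Local Open Scope ring_scope.

(** * Two-sort species with a group action

    Only the data entering a cycle index is recorded.  [str F A B] may contain
    ill-formed objects; the set of F-structures with X-labels [A] and Y-labels
    [B] is [structures F A B].  [relabel F mu nu] is the transport F[mu, nu]. *)
Record species := Species {
  str : finType -> finType -> choiceType;
  structures : forall A B : finType, set (str A B);
  relabel : forall A B : finType, {perm A} -> {perm B} -> str A B -> str A B
}.

Record gspecies (Gamma : finGroupType) := GSpecies {
  gspecies_species :> species;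
  gact : forall A B : finType,
    Gamma -> str gspecies_species A B -> str gspecies_species A B
}.

Definition trivial_gspecies (Gamma : finGroupType) (F : species) :
    gspecies Gamma :=
  @GSpecies Gamma F (fun A B _ t => t).

Definition restrict_gspecies (Gamma : finGroupType) (H : {group Gamma})
    (F : gspecies Gamma) : gspecies [subg H] :=
  @GSpecies [subg H] F (fun A B g t => gact (sgval g) t).

(** * Cycle indices

    A monomial in p_1, p_2, ... is the multiset of its indices: [a i] is the
    exponent of p_i (the index 0, never produced by a permutation, is harmless).
    A formal power series in the p_i[x] and p_j[y] is the
    family of its rational coefficients. *)
Definition monomial : Type := {mset nat}.
Definition fps : Type := monomial -> monomial -> rat.

(* p_mu *)
Definition cycle_type (T : finType) (s : {perm T}) : {mset nat} :=
  seq_mset [seq #|pred_of_set C| | C <- enum (porbits s)].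

Definition mweight (a : {mset nat}) : nat := (\sum_(i <- enum_mset a) i)%N.

Definition fixed (Gamma : finGroupType) (F : gspecies Gamma) (g : Gamma)
    (A B : finType) (mu : {perm A}) (nu : {perm B}) : set (str F A B) :=
  [set t | structures t /\ gact g (relabel mu nu t) = t]%classic.
Arguments fixed {Gamma} F g {A B} mu nu.

Definition cycle_index_term (Gamma : finGroupType) (F : gspecies Gamma)
    (g : Gamma) (m n : nat) : fps := fun a b =>
  ((m`!)%:R * (n`!)%:R)^-1 *
  \sum_(mu : 'S_m) \sum_(nu : 'S_n)
    (#|` fset_set (fixed F g mu nu)|)%:R
    * ((cycle_type mu == a) && (cycle_type nu == b))%:R.

(* The sum over all m, n of [cycle_index_term F g m n]: a monomial occurs only
   in the term whose indices are its weights, see [cycle_index_term0]. *)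
Definition cycle_index (Gamma : finGroupType) (F : gspecies Gamma)
    (g : Gamma) : fps := fun a b =>
  cycle_index_term F g (mweight a) (mweight b) a b.

Definition ordinary_cycle_index (F : species) : fps :=
  cycle_index (trivial_gspecies 'S_1 F) 1%g.

Lemma mweight_cycle_type m (s : 'S_m) : mweight (cycle_type s) = m.
Proof.
rewrite /mweight (perm_big _ (perm_eq_seq_mset _)) big_map big_enum /=.
have /acts_sum_card_orbit : [acts <[s]>%g, on [set: 'I_m] | 'P].
  apply/fintype.subsetP=> t _; rewrite !inE.
  by apply/fintype.subsetP=> x; rewrite !inE.
rewrite cardsT card_ord => e; rewrite -[RHS]e.
have -> // : porbits s = [set orbit 'P <[s]>%G x | x in [set: 'I_m]].
apply/setP=> C; apply/idP/idP=> /imsetP[x _ ->]; apply/imsetP.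
  by exists x; rewrite ?inE ?porbit.unlock.
by exists x; rewrite ?porbit.unlock.
Qed.

Lemma cycle_index_term0 (Gamma : finGroupType) (F : gspecies Gamma) g m n a b :
  (m, n) != (mweight a, mweight b) -> cycle_index_term F g m n a b = 0.
Proof.
move=> ne; rewrite /cycle_index_term big1 ?mulr0 // => mu _.
rewrite big1 // => nu _; case: eqP => [ea|]; case: eqP => [eb|];
  rewrite /= ?mulr0 //.
by move: ne; rewrite -ea -eb !mweight_cycle_type eqxx.
Qed.

(** * k-trees *)

Definition clique (V : finType) (e : rel V) (j : nat) (Q : {set V}) : Prop :=
  #|Q| = j /\ {in Q &, forall u v, u != v -> e u v}.

(* The subgraph of [e] induced on [S] is a k-tree. *)
Inductive ktree_on (k : nat) (V : finType) (e : rel V) : {set V} -> Prop :=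
| ktree_complete (S : {set V}) : clique e k S -> ktree_on k e S
| ktree_extend (S Q : {set V}) (v : V) :
    ktree_on k e S -> v \notin S -> Q \subset S -> clique e k Q ->
    {in S, forall u, e v u = (u \in Q)} -> ktree_on k e (v |: S).

Record labeled_graph (A B : finType) := LabeledGraph {
  order_of : nat;
  adj : rel 'I_order_of;
  hedron : {ffun A -> {set 'I_order_of}};
  front : {ffun B -> {set 'I_order_of}}
}.
Arguments adj {A B} l.

Definition labeled_ktree (k : nat) (A B : finType) (t : labeled_graph A B) :
    Prop :=
  [/\ symmetric (adj t), irreflexive (adj t)
    & ktree_on k (adj t) [set: 'I_(order_of t)]] /\
  [/\ injective (hedron t),
      forall H, clique (adj t) k.+1 H <-> (exists a, hedron t a = H),
      injective (front t)
    & forall Q, clique (adj t) k Q <-> (exists b, front t b = Q)].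

Definition labeled_iso (A B : finType) (t u : labeled_graph A B) : Prop :=
  exists phi : 'I_(order_of t) -> 'I_(order_of u),
  [/\ bijective phi,
      forall v w, adj u (phi v) (phi w) = adj t v w,
      forall a, hedron u a = phi @: hedron t a
    & forall b, front u b = phi @: front t b].

Definition relabel_graph (A B : finType) (mu : {perm A}) (nu : {perm B})
    (t : labeled_graph A B) : labeled_graph A B :=
  LabeledGraph (adj t) [ffun a => hedron t ((mu^-1)%g a)]
                            [ffun b => front t ((nu^-1)%g b)].

(* A structure is an isomorphism class of labeled k-trees. *)
Definition ktree_species (k : nat) : species :=
  @Species (fun A B => set (labeled_graph A B))
    (fun A B C => exists2 t, labeled_ktree k t
                           & C = [set u | labeled_iso t u]%classic)
    (fun A B mu nu C => (relabel_graph mu nu @` C)%classic).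

(* The cardinals in [cycle_index (ktree_species k)] are those of finite sets. *)
Lemma ktree_order_le (k : nat) (A B : finType) (t : labeled_graph A B) :
  (0 < k)%N -> labeled_ktree k t -> (order_of t <= #|B| * k)%N.
Proof.
move=> k0 [[adjC adjn kt] [_ _ _ frontP]].
have cover S : ktree_on k (adj t) S ->
    {in S, forall v, exists2 Q : {set _}, clique (adj t) k Q & v \in Q}.
  elim=> [{}S cS v vS|{}S Q v _ IH vS QS [cQ eQ] vQ w]; first by exists S.
  rewrite !inE => /orP[/eqP->|/IH//].
  have [q qQ] : exists q, q \in Q by apply/card_gt0P; rewrite cQ.
  exists (v |: Q :\ q); last by rewrite !inE eqxx.
  have vNQ : v \notin Q by apply: contra vS; apply/fintype.subsetP.
  split; first by rewrite cardsU1 !inE (negPf vNQ) andbF -cQ [in RHS](cardsD1 q) qQ.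
  move=> x y; rewrite !inE => /orP[/eqP->|/andP[_ xQ]] /orP[/eqP->|/andP[_ yQ]].
  - by rewrite eqxx.
  - by move=> _; rewrite vQ ?(fintype.subsetP QS).
  - by move=> _; rewrite adjC vQ ?(fintype.subsetP QS).
  - exact: eQ.
have sub : [set: 'I_(order_of t)] \subset \bigcup_(b : B) front t b.
  apply/fintype.subsetP=> v /(cover _ kt)[Q /frontP[b <-] vb].
  by apply/bigcupP; exists b.
have := subset_leq_card sub; rewrite cardsT card_ord => /leq_trans; apply.
have -> : (#|B| * k = \sum_(b : B) k)%N by rewrite sum_nat_const.
elim/big_rec2: _ => [|b j S _ leS]; first by rewrite cards0.
have [|cb _] := (frontP (front t b)).2; first by exists b.
by rewrite (leq_trans (leq_card_setU _ _)) // cb leq_add2l.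
Qed.

Lemma finite_ktree_structures (k : nat) (A B : finType) : (0 < k)%N ->
  finite_set (@structures (ktree_species k) A B).
Proof.
move=> k0; pose N := (#|B| * k)%N.
pose D := {n : 'I_N.+1 & ({ffun 'I_n * 'I_n -> bool} *
            {ffun A -> {set 'I_n}} * {ffun B -> {set 'I_n}})%type}.
pose f (d : D) : set (labeled_graph A B) :=
  let: existT n (e, h, g) := d in
  [set u | labeled_iso (LabeledGraph (fun x y => e (x, y)) h g) u]%classic.
apply: (@sub_finite_set _ _ (range f)); last first.
  exact/finite_image/finite_finset.
move=> C [t kt ->]; have nN := ktree_order_le k0 kt.
case: t kt nN => n e h r kt /= nN.
exists (existT (fun n : 'I_N.+1 => ({ffun 'I_n * 'I_n -> bool} *
            {ffun A -> {set 'I_n}} * {ffun B -> {set 'I_n}})%type)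
  (@Ordinal N.+1 n nN) ([ffun p => e p.1 p.2], h, r)) => //=.
congr (fun g => [set u | labeled_iso (LabeledGraph g h r) u]%classic).
by apply/funext => x; apply/funext => y; rewrite ffunE.
Qed.

(** * k-coding trees *)

Definition is_tree (T : finType) (e : rel T) : Prop :=
  [/\ (0 < #|T|)%N, symmetric e, irreflexive e, forall x y, connect e x y
    & forall s : seq T, ucycle e s -> (size s <= 2)%N].

(* Black vertices are [A], white vertices are [B].  [c a b] is the white vertex
   following [b] in the cyclic order around [a] if [b] is a neighbor of [a],
   and is [b] otherwise; for k >= 1 the neighbors of [a] are thus the points
   moved by [c a]. *)
Definition coding (A B : finType) : Type := {ffun A -> {ffun B -> B}}.

Definition coding_adj (A B : finType) (c : coding A B) : rel (A + B) :=
  fun u v => match u, v with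
             | inl a, inr b | inr b, inl a => c a b != b
             | _, _ => false
             end.

Definition coding_tree (k : nat) (A B : finType) (c : coding A B) : Prop :=
  (forall a, exists s : seq B, [/\ size s = k.+1, uniq s & c a =1 next s]) /\
  is_tree (coding_adj c).

Definition relabel_coding (A B : finType) (mu : {perm A}) (nu : {perm B})
    (c : coding A B) : coding A B :=
  [ffun a => [ffun b => nu (c ((mu^-1)%g a) ((nu^-1)%g b))]].

(** * The actions

    Positions 1, ..., k + 1 are taken modulo k + 1: the position k + 1 of the
    parent is [0 : 'I_k.+1]. *)
Definition Sk (k : nat) : {group 'S_k.+1} := 'C[ord0 : 'I_k.+1 | 'P]%G.

Lemma rho_inj (k : nat) (i : 'I_k.+1) (s : 'S_k.+1) :
  injective (fun a => s (i + a) - s i).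
Proof. by move=> a b /addIr /perm_inj /addrI. Qed.

Definition rho (k : nat) (i : 'I_k.+1) (s : 'S_k.+1) : 'S_k.+1 :=
  perm (@rho_inj k i s).

(* In a tree, the neighbor of [v] toward the root [r]; [None] if [v] = [r]. *)
Definition parent (T : finType) (e : rel T) (r v : T) : option T :=
  [pick u | e v u & connect [rel x y | [&& e x y, x != v & y != v]] u r].

Section Action.
Variables (k : nat) (A B : finType).
(* The tree [c] is rooted at the vertex [root].  [y] is the white root vertex
   or, when [root] is black, the white vertex of the root edge. *)
Variables (root : A + B) (y : B) (c : coding A B).

(* The white neighbor of [a] in position k + 1. *)
Definition last_nbr (a : A) : B :=
  if parent (coding_adj c) root (inl a) is Some (inr p) then p else y.

Definition nbr (a : A) (i : 'I_k.+1) : B := iter i (c a) (last_nbr a).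

Definition position (a : A) (p : B) : 'I_k.+1 :=
  odflt 0 [pick i | nbr a i == p].

(* Unfolding the recursive definition of the action of [s] at the root: at the
   black vertex [a] the list W_1, ..., W_{k+1} is permuted by [local_perm],
   which is [s] at the topmost black vertices, and rho_i of the permutation at
   the black vertex above [a] if [a] lies in its branch W_i.  [fuel] bounds the
   number of black vertices above [a]. *)
Fixpoint local_perm (fuel : nat) (s : 'S_k.+1) (a : A) : 'S_k.+1 :=
  if fuel is fuel'.+1 then
    if parent (coding_adj c) root (inl a) is Some (inr p) then
      if parent (coding_adj c) root (inr p) is Some (inl a') then
        rho (position a' p) (local_perm fuel' s a')
      else s
    else s
  else s.

(* W'_j = W_{s^-1(j)}, where s is the local permutation. *)
Definition new_nbr (s : 'S_k.+1) (a : A) (j : 'I_k.+1) : B :=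
  nbr a (((local_perm #|A| s a)^-1)%g j).

Definition act_coding (s : 'S_k.+1) : coding A B :=
  [ffun a => [ffun b => next [seq new_nbr s a j | j <- enum 'I_k.+1] b]].

End Action.

Definition CTY (k : nat) : gspecies [subg Sk k] :=
  @GSpecies [subg Sk k]
    (@Species (fun A B => (B * coding A B)%type)
       (fun A B t => coding_tree k t.2)
       (fun A B mu nu t => (nu t.1, relabel_coding mu nu t.2)))
    (fun A B s t => (t.1, act_coding (inr t.1) t.1 t.2 (sgval s))).

(* ((x, y), c) is the coding tree c rooted at the edge x - y. *)
Definition CTXY (k : nat) : gspecies 'S_k.+1 :=
  @GSpecies 'S_k.+1
    (@Species (fun A B => ((A * B) * coding A B)%type)
       (fun A B t => coding_tree k t.2 /\ coding_adj t.2 (inl t.1.1) (inr t.1.2))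
       (fun A B mu nu t => ((mu t.1.1, nu t.1.2), relabel_coding mu nu t.2)))
    (fun A B s t =>
       ((t.1.1, new_nbr (inl t.1.1) t.1.2 t.2 s t.1.1 0),
        act_coding (inl t.1.1) t.1.2 t.2 s)).

(* Main.v *)
Require Import Defs.
From mathcomp Require Import all_boot all_order all_algebra all_fingroup.
From mathcomp Require Import finmap.
From mathcomp Require Import boolp classical_sets cardinality.
From mathcomp Require Import zify.
Import GRing.Theory.
Local Open Scope ring_scope.
Set Implicit Arguments.
Unset Strict Implicit.
Unset Printing Implicit Defensive.

(** Color the vertices of a k-tree with k + 1 colors so that adjacent vertices
    get different colors. Such a coloring exists, because a new vertex is
    joined to a k-clique and takes the color missing from it; it is unique up
    to a permutation of the colors ([ktree_coloring], [coloring_uniq]). A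
    front then misses exactly one color, and the k + 1 fronts of a hedron miss
    different colors. What remains of a colored k-tree is a _colored tree_:
    the incidence tree of hedra (black) and fronts (white), with a color on
    each white vertex such that the neighbors of a black vertex have all k + 1
    colors.

    - Colored trees up to a permutation of the colors are k-trees. The
      incidence graph is a tree and determines the k-tree because the cliques
      containing a given vertex are connected in it ([incidence_tree],
      [matches_inj]); every colored tree arises because its black vertices can
      be added one by one as hedra ([represents_realize]).
    - A rooted coding tree is a colored tree in which the white root, or the
      white end of the root edge, has color 0: listing the neighbors of every
      black vertex by increasing color gives the cyclic orders ([coding_of]),
      and the cyclic orders give back the colors ([coding_of_surj],
      [coding_of_inj]). Under this correspondence the recursive action of a
      permutation only applies it to all the colors ([act_coding_of]).

    Fix relabelings mu and nu. A permutation s of the colors contributes the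
    colored trees d that mu, nu and s together fix, and mu and nu then act on
    d by a tree automorphism preserving the two kinds of vertices. Such an
    automorphism fixes one vertex more than edges ([tree_dissymmetry]).
    Summing over d and s, the fixed black vertices are counted by the
    S_(k+1)-species CT^XY. By conjugation the k + 1 colors contribute equally
    to the fixed white vertices and to the fixed edges, so that these are
    counted, up to the factor k + 1, by the S_k-species CT^Y and CT^XY, in
    which the color is 0 ([sum_dissymmetry]). What is left is the number of
    pairs (d, s), which by Burnside's lemma is (k + 1)! times the number of
    k-trees fixed by mu and nu ([card_fixed_ktree]). *)

(** * Rooted trees *)

Lemma connect_homo (T U : finType) (e : rel T) (f : rel U) (g : T -> U) x y :
  (forall v w, e v w -> f (g v) (g w)) -> connect e x y ->
  connect f (g x) (g y).
Proof.
move=> eg /connectP[p + ->]; elim: p x => [|z p IH] x //= /andP[/eg xz zp].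
exact: connect_trans (connect1 xz) (IH _ zp).
Qed.

Definition avoid (T : finType) (e : rel T) (v : T) : rel T :=
  [rel x y | [&& e x y, x != v & y != v]].

Section Tree.
Variables (T : finType) (e : rel T).
Hypothesis te : is_tree e.

Let eC : symmetric e. Proof. by case: te. Qed.

Lemma tree_neq u v : e u v -> u != v.
Proof. by case: te => _ _ ei _ _ uv; apply/eqP=> E; rewrite E ei in uv. Qed.

Lemma avoid_sym v : connect_sym (avoid e v).
Proof. by apply: sym_connect_sym => x y;
  rewrite /avoid /= (eC x) [(x != v) && _]andbC. Qed.

Lemma path_avoid v u p :
  path (avoid e v) u p = path e u p && ((p != [::]) ==> (v \notin u :: p)).
Proof.
elim: p u => [|w p IH] u; first by rewrite andbT.
rewrite /= {}IH !inE !negb_or /avoid /= (eq_sym v u) (eq_sym v w).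
case: (e u w) => //=; case: (path e w p); rewrite ?andbF //=.
by case: p => [|z p] /=; rewrite ?andbT //; case: (w != v);
  rewrite ?andbF ?andbT.
Qed.

(** A path from [u] to [w] that avoids [v] would close up through [v]. *)
Lemma nbr_separated v u w : e v u -> e v w -> connect (avoid e v) u w -> u = w.
Proof.
move=> vu vw /connectP[p0 pp0 E]; move: vw.
case: (shortenP pp0) E => p pp up _ -> vl.
case: p pp up vl => // z p pp up vl.
move: pp; rewrite path_avoid => /andP[pp vN].
have uc : ucycle e [:: v, u, z & p].
  apply/andP; split; last by rewrite cons_uniq up andbT; move: vN.
  change (e v u && path e u (rcons (z :: p) v)).
  by rewrite vu rcons_path pp eC vl.
by have := let: And5 _ _ _ _ c := te in c _ uc.
Qed.

(** By [nbr_separated] at most one neighbor of [v] is joined to [r] away from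
    [v], so that [parent] depends on no choice. *)
Lemma parentP r v u :
  parent e r v = Some u <-> e v u /\ connect (avoid e v) u r.
Proof.
rewrite /parent; case: pickP => [w /andP[vw wr]|no]; last first.
  by split=> // -[vu ur]; have := no u; rewrite /= vu ur.
split=> [[<-]//|[vu ur]]; congr Some; apply: (@nbr_separated v) => //.
by apply: connect_trans wr _; rewrite avoid_sym.
Qed.

Lemma parent_root r : parent e r r = None.
Proof.
case E: (parent e r r) => [u|] //; have [ru] := (parentP r r u).1 E.
rewrite avoid_sym => /connectP[[|z p]] /=.
  by move=> _ ur; have := tree_neq ru; rewrite ur eqxx.
by rewrite /avoid /= eqxx andbF.
Qed.

Lemma parent_adj r v u : parent e r v = Some u -> e v u.
Proof. by case/parentP. Qed.

Lemma short_path_parent r v u p : path e v (u :: p) -> uniq (v :: u :: p) ->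
  last u p = r -> parent e r v = Some u.
Proof.
move=> /= /andP[vu pp] /andP[vN _] lr; apply/parentP; split=> //.
by apply/connectP; exists p => //; rewrite path_avoid pp vN implybT.
Qed.

(** The height is the distance to [r]: the first step of a shortest path to [r]
    is the parent. Recursions toward the root terminate because of it. *)
Lemma parent_height r : exists h : T -> nat,
  (forall v u, parent e r v = Some u -> (h u < h v)%N) /\
  (forall v, v != r -> exists u, parent e r v = Some u).
Proof.
pose P v n := `[< exists p, [/\ path e v p, last v p = r & size p = n] >].
have ex v : exists n, P v n.
  have /connectP[p pp E] := let: And5 _ _ _ c _ := te in c v r.
  by exists (size p); apply/asboolP; exists p.
have first v : v != r -> exists u p, [/\ parent e r v = Some u, path e u p,
    last u p = r & (size p < ex_minn (ex v))%N].
  move=> vr; case: ex_minnP => n /asboolP[p [pp lr <-]] _.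
  case: (shortenP pp) lr => -[|u q] qq uq sq lr;
    first by rewrite -lr eqxx in vr.
  exists u, q; split=> //; first exact: short_path_parent qq uq lr.
    by case/andP: qq.
  by rewrite -[(_ < _)%N]/(size (u :: q) <= size p)%N uniq_leq_size //;
    case/andP: uq.
exists (fun v => ex_minn (ex v)); split=> [v u vu|v vr]; last first.
  by have [u [p []]] := first v vr; exists u.
have vr : v != r by apply/eqP=> E; rewrite E parent_root in vu.
have [u' [p [vu' pp lr lp]]] := first v vr.
move: vu'; rewrite vu => -[E]; rewrite -E in pp lr; apply: leq_ltn_trans lp.
by case: ex_minnP => n _; apply; apply/asboolP; exists p.
Qed.

Lemma parent_some r v : v != r -> exists u, parent e r v = Some u.
Proof. by have [h [_]] := parent_height r; apply. Qed.

(** If [w] is not the parent of [v], the path from [v] to [r] through the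
    parent avoids [w]: reaching [w], it would join two neighbors of [v] away
    from [v]. *)
Lemma parent_total r v w : e v w ->
  parent e r v = Some w \/ parent e r w = Some v.
Proof.
move=> vw; have [<-|vr] := eqVneq v r; first by right; apply/parentP;
  rewrite eC.
have [u /[dup] pv /parentP[vu]] := parent_some vr.
have [<-|uw] := eqVneq u w; first by left.
move=> /connectP[p pp lr]; right; apply/parentP; rewrite eC vw; split=> //.
have wN : w \notin v :: u :: p.
  rewrite !inE (eq_sym w u) (negPf uw) eq_sym (negPf (tree_neq vw)) /=.
  apply/negP=> wp; case/eqP: uw; apply: (@nbr_separated v) => //.
  case/splitPl: {wp p lr} _ / (mem_behead (s := u :: p) wp) pp => p1 p2 E.
  by rewrite cat_path -E => /andP[pp _]; apply/connectP; exists p1.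
apply/connectP; exists (u :: p); last by rewrite lr.
by rewrite path_avoid wN implybT andbT /= vu; move: pp; rewrite path_avoid;
  case/andP.
Qed.

Lemma parent_asym r v w : parent e r v = Some w -> parent e r w <> Some v.
Proof.
have [h [hlt _]] := parent_height r.
by move=> /hlt vw /hlt /(ltn_trans vw); rewrite ltnn.
Qed.

Lemma parent_equiv (g : T -> T) r v : injective g ->
  (forall x y, e (g x) (g y) = e x y) ->
  parent e (g r) (g v) = omap g (parent e r v).
Proof.
move=> gI ge; have [->|vr] := eqVneq v r; first by rewrite !parent_root.
have [u E] := parent_some vr; rewrite E /=; have [vu ur] := (parentP r v u).1 E.
apply/parentP; rewrite ge vu; split=> //; apply: connect_homo ur => x y.
by rewrite /avoid /= ge !(inj_eq gI).
Qed.

(** Every antisymmetric function on the edges of a tree is a coboundary: add up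
    its values along the path to the root. This is what colors coding trees. *)
Lemma tree_potential (Z : zmodType) (w : T -> T -> Z) (r : T) :
  (forall x y, w x y = - w y x) ->
  exists f : T -> Z, f r = 0 /\ forall x y, e x y -> f y = f x + w x y.
Proof.
move=> wN; have [h [hlt _]] := parent_height r.
pose fix F (n : nat) (v : T) {struct n} : Z :=
  if n is n'.+1 then
    if parent e r v is Some u then F n' u + w u v else 0 else 0.
have F_stable n m v : (h v <= n)%N -> (h v <= m)%N -> F n v = F m v.
  elim: n m v => [|n IH] [|m] v //= hn hm; case E: (parent e r v) => [u|] //.
  - by have := leq_trans (hlt _ _ E) hn.
  - by have := leq_trans (hlt _ _ E) hm.
  by have hu := hlt _ _ E; rewrite (IH m) //; rewrite -ltnS;
    apply: leq_trans hu _.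
pose f v := F (h v) v; exists f.
have fp u v : parent e r v = Some u -> f v = f u + w u v.
  move=> E; have := hlt _ _ E; rewrite {1}/f; case: (h v) => //= n hu.
  by rewrite E (F_stable n (h u)).
split=> [|x y /(parent_total r)[/fp->|/fp->//]];
  last by rewrite (wN y x) addrNK.
by rewrite /f; case: (h r) => //= n; rewrite parent_root.
Qed.

Lemma tree_constant (I : eqType) (f g : T -> I) r :
  (forall x y, e x y -> f x = g x -> f y = g y) -> f r = g r -> f =1 g.
Proof.
move=> fg fr v; have /connectP[p pp ->] := let: And5 _ _ _ c _ := te in c r v.
elim: p r fr pp => [|z p IH] x //= fx /andP[xz zp]; apply: IH => //.
exact: fg xz fx.
Qed.

End Tree.

(** * Fixed vertices and fixed edges of a tree automorphism *)

Definition sum_map (A B : finType) (mu : {perm A}) (nu : {perm B})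
    (v : A + B) : A + B :=
  match v with inl a => inl (mu a) | inr b => inr (nu b) end.

Lemma sum_map_inj (A B : finType) (mu : {perm A}) (nu : {perm B}) :
  injective (sum_map mu nu).
Proof. by move=> [a|b] [a'|b'] //= [/perm_inj->]. Qed.

Definition is_black (A B : Type) (v : A + B) : bool :=
  if v is inl _ then true else false.

Section Dissymmetry.
Variables (A B : finType) (e : rel (A + B)).
Hypothesis te : is_tree e.
Hypothesis bip : forall v w, e v w -> is_black v != is_black w.
Local Notation T := (A + B)%type.

Let eC : symmetric e. Proof. by case: te. Qed.

(** An orientation with at most one edge leaving each vertex matches the edges
    with the vertices other than sinks, an edge with its tail. When [g]
    preserves it, an edge is fixed exactly when its tail is. *)
Lemma orientation_count (g : T -> T) (o : T -> option T) :
  injective g -> (forall v, is_black (g v) = is_black v) ->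
  (forall v u, o v = Some u -> e v u) ->
  (forall v u, e v u -> (o u == Some v) = (o v != Some u)) ->
  (forall v, o (g v) = omap g (o v)) ->
  (#|[set v | (g v == v) && (o v == None)]|
   + #|[set p : A * B | [&& g (inl p.1) == inl p.1, g (inr p.2) == inr p.2
                          & e (inl p.1) (inr p.2)]]|
   = #|[set v | g v == v]|)%N.
Proof.
move=> gI gs oe oo og; set E : {set A * B} :=
  [set p | [&& g (inl p.1) == inl p.1, g (inr p.2) == inr p.2
             & e (inl p.1) (inr p.2)]].
pose tail (p : A * B) : T :=
  if o (inl p.1) == Some (inr p.2) then inl p.1 else inr p.2.
rewrite -[RHS](cardsID [set v | o v == None]); congr (_ + _)%N.
  by congr #|pred_of_set _|; apply/setP=> v; rewrite !inE.
have tailI : {in E &, injective tail}.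
  move=> [a b] [a' b']; rewrite !inE /tail /= => /and3P[_ _ ab] /and3P[_ _ ab'].
  case: ifP => [/eqP oa|/negP oa]; case: ifP => [/eqP oa'|/negP oa'] //.
    by case=> E1; move: oa'; rewrite -E1 oa => -[->].
  case=> E1; rewrite -{}E1 in ab' oa' *.
  have := oo _ _ ab; have := oo _ _ ab'.
  move/negP: oa => -> ; move/negP: oa' => -> /eqP-> /eqP[->] //.
rewrite -(card_in_imset tailI); congr #|pred_of_set _|; apply/setP=> v.
rewrite !inE; apply/imsetP/andP => [[[a b]]|[ov /eqP gv]].
  rewrite !inE /tail /= => /and3P[ga gb ab] ->.
  by case: ifP (oo _ _ ab) => [/eqP->|_ /eqP->].
case E1: (o v) ov => [u|] // _.
have gu : g u = u by have := og v; rewrite gv E1 /= => -[].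
have vu := oe _ _ E1; have := oo _ _ vu; rewrite E1 eqxx /= => /negbT ou.
case: v u vu gu gv E1 ou (bip vu) => [a|b] [a'|b'] // vu gu gv E1 ou _.
  by exists (a, b'); rewrite ?inE /tail /= ?gu ?gv ?eqxx ?E1 ?eqxx.
by exists (a', b); rewrite ?inE /tail /= ?gu ?gv ?eqxx ?(negPf ou) // eC.
Qed.

(** The vertices that [v] sees through its neighbor [u], as the roots for which
    [u] is the parent of [v]. Different neighbors get disjoint branches because
    [parent] is a function. *)
Definition branch (v u : T) : {set T} := [set x | parent e x v == Some u].

(** Edges point to their heavier side, and from black to white when both sides
    have the same size. Every automorphism preserving the two kinds of vertices
    preserves this orientation, unlike an orientation toward a root. *)
Definition heavy (v : T) : option T :=
  [pick u | e v u & (#|{: T}| < #|branch v u| * 2 + is_black v)%N].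

Lemma branch_edge v u : e v u -> (#|branch v u| + #|branch u v| = #|{: T}|)%N.
Proof.
move=> vu; rewrite -cardsUI -[RHS]addn0; congr (_ + _)%N.
  rewrite -cardsT; congr #|pred_of_set _|; apply/setP=> x; rewrite !inE.
  by case: (parent_total te x vu) => ->; rewrite eqxx ?orbT.
apply/eqP; rewrite cards_eq0 -finset.subset0; apply/fintype.subsetP=> x;
  rewrite !inE.
by move=> /andP[/eqP vx /eqP ux]; case: (parent_asym te vx ux).
Qed.

Lemma branch_disjoint v u w : u != w ->
  (#|branch v u| + #|branch v w| < #|{: T}|)%N.
Proof.
move=> uw; rewrite -cardsUI; have -> : branch v u :&: branch v w = finset.set0.
  apply/setP=> x; rewrite !inE; apply/negP=> /andP[/eqP-> /eqP[E]].
  by rewrite E eqxx in uw.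
rewrite cards0 addn0 -cardsT; apply: proper_card; apply/properP; split=> //.
by exists v; rewrite ?inE ?(parent_root te).
Qed.

(** Two edges leaving [v] would have disjoint branches that together have at
    least as many vertices as the tree, although [v] is in neither. *)
Lemma heavyP v u :
  heavy v = Some u <-> e v u /\ (#|{: T}| < #|branch v u| * 2 + is_black v)%N.
Proof.
rewrite /heavy; case: pickP => [w /andP[vw hw]|no]; last first.
  by split=> // -[vu hu]; have := no u; rewrite /= vu hu.
split=> [[<-]//|[vu hu]]; congr Some; apply/eqP; apply: contraLR hu => uw.
rewrite eq_sym in uw.
have := branch_disjoint v uw; move: hw; case: (is_black v); rewrite -leqNgt;
  lia.
Qed.

Lemma heavy_flip v u : e v u -> (heavy u == Some v) = (heavy v != Some u).
Proof.
move=> vu; have uv : e u v by rewrite eC.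
have hE x y : e x y ->
    (heavy x == Some y) = (#|{: T}| < #|branch x y| * 2 + is_black x)%N.
  by move=> xy; apply/eqP/idP => [/heavyP[]//|h]; apply/heavyP.
rewrite !hE // -leqNgt; have := branch_edge vu; have := bip vu.
case: (is_black v); case: (is_black u) => //= _; lia.
Qed.

Lemma heavy_equiv (g : T -> T) v : injective g ->
  (forall v, is_black (g v) = is_black v) ->
  (forall x y, e (g x) (g y) = e x y) ->
  heavy (g v) = omap g (heavy v).
Proof.
move=> gI gs ge; have bg x y : #|branch (g x) (g y)| = #|branch x y|.
  rewrite -[RHS](card_imset _ gI); congr #|pred_of_set _|; apply/setP=> z.
  have [g' _ gK] : bijective g by apply: injF_bij.
  rewrite -(gK z) mem_imset // !inE (parent_equiv te) //.
  by case: (parent e _ x) => [w|] //=; rewrite !(inj_eq Some_inj) ?(inj_eq gI).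
have hg x y : heavy x = Some y -> heavy (g x) = Some (g y).
  by move=> /heavyP[xy h]; apply/heavyP; rewrite ge bg gs.
case E: (heavy v) => [u|] /=; first exact: hg.
case E': (heavy (g v)) => [u|] //.
have [g' _ gK] : bijective g by apply: injF_bij.
move: E'; rewrite -(gK u) => /heavyP; rewrite ge bg gs => /heavyP.
by rewrite E.
Qed.

(** The centroid, which is the only sink of [heavy], is fixed; the other fixed
    vertices are the tails of the fixed edges. *)
Theorem tree_dissymmetry (mu : {perm A}) (nu : {perm B}) :
  (forall x y, e (sum_map mu nu x) (sum_map mu nu y) = e x y) ->
  (#|[set a | mu a == a]| + #|[set b | nu b == b]|
   = #|[set p : A * B | [&& mu p.1 == p.1, nu p.2 == p.2
                          & e (inl p.1) (inr p.2)]]| + 1)%N.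
Proof.
move=> ge; pose g := sum_map mu nu.
have gI : injective g := @sum_map_inj _ _ mu nu.
have gs v : is_black (g v) = is_black v by case: v.
have hg v := heavy_equiv v gI gs ge.
have hoe v u : heavy v = Some u -> e v u by move=> /heavyP[].
have count_id o := @orientation_count id o (fun _ _ => id) (fun _ => erefl).
have [r _] : exists r : T, true.
  by have /card_gt0P[r _] := let: And5 c _ _ _ _ := te in c; exists r.
(* Like the orientation toward a root, [heavy] has exactly one sink. *)
have one : #|[set v | heavy v == None]| = 1%N.
  have pf v u : e v u -> (parent e r u == Some v) = (parent e r v != Some u).
    move=> vu; apply/eqP/idP => [/(parent_asym te)E|E]; first exact/eqP.
    by case: (parent_total te r vu) E => [->|//]; rewrite eqxx.
  have := count_id _ (@parent_adj _ _ te r) pf (fun v => esym (omap_id _)).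
  rewrite -(count_id heavy hoe heavy_flip (fun v => esym (omap_id _))).
  move=> /addIn E; transitivity #|[set v | (v == v) && (parent e r v == None)]|.
    by rewrite E; congr #|pred_of_set _|; apply/setP=> v; rewrite !inE eqxx.
  rewrite -[RHS](cards1 r); congr #|pred_of_set _|.
  apply/setP=> v; rewrite !inE eqxx; apply/eqP/eqP => [pv|->];
    last exact: parent_root.
  by apply/eqP; apply: contraT => /(parent_some te)[u]; rewrite pv.
have [s sE] := cards1P (introT eqP one).
have sinkE v : (heavy v == None) = (v == s) by move/setP/(_ v): sE;
  rewrite !inE.
have gs1 : g s == s.
  by rewrite -sinkE hg; have := eqxx s; rewrite -sinkE => /eqP->.
have := orientation_count gI gs hoe heavy_flip hg.
have -> : [set v | (g v == v) && (heavy v == None)] = [set s].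
  by apply/setP=> v; rewrite !inE sinkE andbC; case: eqP => // ->.
rewrite cards1 addnC -!sum1dep_card big_sumType /= => <-.
by congr (_ + _)%N; apply: eq_bigl => -[a b].
Qed.

End Dissymmetry.

(** * Colored incidence trees *)

Section Colored.
Variables (k : nat) (A B : finType).
Local Notation color := 'I_k.+1.

(** [d.1 a] is the set of fronts of the hedron [a], and [d.2 b] the color of
    the front [b], which in a colored k-tree is the color missing from [b]. *)
Definition colored_tree : Type :=
  ({ffun A -> {set B}} * {ffun B -> color})%type.

Definition inc_adj (I : A -> {set B}) : rel (A + B) :=
  fun u v => match u, v with
             | inl a, inr b | inr b, inl a => b \in I a
             | _, _ => false
             end.

Definition valid (d : colored_tree) : Prop :=
  is_tree (inc_adj d.1) /\
  forall a, #|d.1 a| = k.+1 /\ {in d.1 a &, injective d.2}.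

Definition recolor (s : 'S_k.+1) (d : colored_tree) : colored_tree :=
  (d.1, [ffun b => s (d.2 b)]).

Definition relabel_tree (mu : {perm A}) (nu : {perm B}) (d : colored_tree) :
  colored_tree :=
  ([ffun a => nu @: d.1 ((mu^-1)%g a)], [ffun b => d.2 ((nu^-1)%g b)]).

(** The argument [b] is only a default value, as [B] may be empty. *)
Definition nbr_of_color (b : B) (d : colored_tree) (a : A) (i : color) : B :=
  odflt b [pick b' in d.1 a | d.2 b' == i].

Definition coding_of (d : colored_tree) : coding A B :=
  [ffun a => [ffun b =>
    if b \in d.1 a then nbr_of_color b d a (d.2 b + inZp 1) else b]].

Lemma inc_bip I v w : inc_adj I v w -> is_black v != is_black w.
Proof. by case: v; case: w. Qed.

Lemma valid_recolor s d : valid d -> valid (recolor s d).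
Proof.
move=> [td hd]; split=> // a; have [cd ci] := hd a; split=> // b b' ib ib'.
by rewrite !ffunE => /perm_inj /ci ->.
Qed.

Lemma nbr_of_colorP (b : B) d a i : valid d ->
  nbr_of_color b d a i \in d.1 a /\ d.2 (nbr_of_color b d a i) = i.
Proof.
move=> [_ /(_ a)[cd ci]]; rewrite /nbr_of_color;
  case: pickP => [b' /andP[-> /eqP] //|no].
have : i \in d.2 @: d.1 a.
  suff -> : d.2 @: d.1 a = [set: color] by rewrite inE.
  by apply/eqP; rewrite eqEcard finset.subsetT cardsT card_ord card_in_imset //
    cd /=.
by case/imsetP=> b' ib ei; have := no b'; rewrite /= ib ei eqxx.
Qed.

Lemma nbr_of_color_inc (b : B) d a i :
  valid d -> nbr_of_color b d a i \in d.1 a.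
Proof. by move=> /(nbr_of_colorP b a i)[]. Qed.

Lemma nbr_of_color_col (b : B) d a i :
  valid d -> d.2 (nbr_of_color b d a i) = i.
Proof. by move=> /(nbr_of_colorP b a i)[]. Qed.

Lemma nbr_of_color_uniq (b : B) d a i b' :
  valid d -> b' \in d.1 a -> d.2 b' = i ->
  nbr_of_color b d a i = b'.
Proof.
move=> vd ib' ci; have [ib cb] := nbr_of_colorP b a i vd.
by case: vd => _ /(_ a)[_]; apply=> //; rewrite cb.
Qed.

Lemma relabel_tree_inc (mu : {perm A}) (nu : {perm B}) (d : colored_tree) a b :
  (nu b \in (relabel_tree mu nu d).1 (mu a)) = (b \in d.1 a).
Proof. by rewrite ffunE permK mem_imset //; apply: perm_inj. Qed.

Lemma relabel_tree_col (mu : {perm A}) (nu : {perm B}) (d : colored_tree) b :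
  (relabel_tree mu nu d).2 (nu b) = d.2 b.
Proof. by rewrite ffunE permK. Qed.

Lemma relabel_tree_adj (mu : {perm A}) (nu : {perm B}) (d : colored_tree) u v :
  inc_adj (relabel_tree mu nu d).1 (sum_map mu nu u) (sum_map mu nu v)
  = inc_adj d.1 u v.
Proof. by case: u v => [a|b] [a'|b'] //=; rewrite relabel_tree_inc. Qed.

Lemma is_tree_iso (T U : finType) (e : rel T) (f : rel U) (g : T -> U) :
  bijective g -> (forall x y, f (g x) (g y) = e x y) -> is_tree e -> is_tree f.
Proof.
move=> gb fg [t0 es ei ec ey]; case: (gb) => h hK gK; split.
- by rewrite -(bij_eq_card gb).
- by move=> x y; rewrite -(gK x) -(gK y) !fg es.
- by move=> x; rewrite -(gK x) fg ei.
- move=> x y; rewrite -(gK x) -(gK y).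
  by apply: connect_homo (ec _ _) => v w; rewrite fg.
move=> s; rewrite -(mapK gK s) size_map => /andP[cs us]; apply: ey.
rewrite /ucycle (map_inj_uniq (can_inj hK)) in us cs *; rewrite us andbT.
by rewrite -(mono_cycle fg).
Qed.

Lemma valid_relabel_tree (mu : {perm A}) (nu : {perm B}) d :
  valid d -> valid (relabel_tree mu nu d).
Proof.
move=> [td hd]; split=> [|a].
  apply: is_tree_iso (relabel_tree_adj mu nu d) td.
  by apply: injF_bij; apply: sum_map_inj.
have [cd ci] := hd ((mu^-1)%g a); split.
  by rewrite ffunE card_imset //; apply: perm_inj.
move=> b b'; rewrite -(permKV nu b) -(permKV nu b') -(permKV mu a)
  !relabel_tree_inc.
by rewrite !relabel_tree_col => ib ib' /ci-> //; rewrite permK.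
Qed.

Implicit Types (d : colored_tree) (a : A) (b : B) (i : color).

(** ** The cyclic orders of a colored tree *)

Hypothesis k0 : (0 < k)%N.

Lemma ord1_neq0 : inZp 1 != 0 :> color.
Proof. by rewrite -val_eqE /= modn_small. Qed.

Lemma addr1_neq (i : color) : i + inZp 1 != i.
Proof. by rewrite -subr_eq0 addrC addKr ord1_neq0. Qed.

Lemma coding_of_step d a b : valid d -> b \in d.1 a ->
  coding_of d a b \in d.1 a /\ d.2 (coding_of d a b) = d.2 b + inZp 1.
Proof. by move=> vd ib; rewrite !ffunE ib; split;
  [exact: nbr_of_color_inc|exact: nbr_of_color_col]. Qed.

Lemma coding_of_out d a b : b \notin d.1 a -> coding_of d a b = b.
Proof. by move=> ib; rewrite !ffunE (negPf ib). Qed.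

Lemma coding_of_moves d a b : valid d -> (coding_of d a b != b) = (b \in d.1 a).
Proof.
move=> vd; case: (boolP (b \in d.1 a)) => ib;
  last by rewrite coding_of_out ?eqxx.
by apply/eqP=> E; have [_] := coding_of_step vd ib; rewrite E => /esym/eqP;
  rewrite (negPf (addr1_neq _)).
Qed.

Lemma coding_of_adj d : valid d -> coding_adj (coding_of d) = inc_adj d.1.
Proof.
move=> vd; apply/funext=> -[a|b]; apply/funext=> -[a'|b'] //=;
  exact: coding_of_moves.
Qed.

Lemma iter_coding_of d a b n : valid d -> b \in d.1 a ->
  iter n (coding_of d a) b \in d.1 a /\ d.2 (iter n (coding_of d a) b)
    = d.2 b + inZp n.
Proof.
move=> vd ib; elim: n => [|n [IHi IHc]] /=.
  by split=> //; rewrite -[LHS]addr0; congr (_ + _); apply/val_inj;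
    rewrite /= mod0n.
have [ic ->] := coding_of_step vd IHi; split=> //; rewrite IHc -addrA;
  congr (_ + _).
by apply/val_inj; rewrite /= modnDm addn1.
Qed.

Lemma next_nth_mod (T : eqType) (s : seq T) x0 x : x \in s ->
  next s x = nth x0 s ((index x s).+1 %% size s).
Proof.
move=> xs; rewrite next_nth xs; case: s xs => // y s xs.
have := xs; rewrite -index_mem /= ltnS leq_eqVlt => /orP[/eqP->|lt].
  by rewrite nth_default // modnn.
by rewrite modn_small //; apply: set_nth_default.
Qed.

Lemma next_ord (f : color -> B) i : injective f ->
  next [seq f j | j <- enum color] (f i) = f (i + inZp 1).
Proof.
move=> fI; rewrite next_map ?enum_uniq //; congr f.
rewrite (next_nth_mod i) ?mem_enum // index_enum_ord size_enum_ord.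
apply: val_inj; rewrite /= nth_enum_ord ?ltn_pmod //.
by rewrite modnDmr addn1.
Qed.

End Colored.

Section CodingTrees.
Variables (k : nat) (A B : finType).
Hypothesis k0 : (0 < k)%N.
Local Notation color := 'I_k.+1.
Local Notation colored_tree := (colored_tree k A B).
Implicit Types (d : colored_tree) (a : A) (b : B) (i : color) (c : coding A B).

Lemma coding_tree_coding_of d : valid d -> coding_tree k (coding_of d).
Proof.
move=> vd; split=> [a|]; last by rewrite coding_of_adj //; case: vd.
have /card_gt0P[b0 _] : (0 < #|d.1 a|)%N by case: (vd) => _ /(_ a)[-> _].
have fI : injective (nbr_of_color b0 d a).
  by move=> i j E; rewrite -(nbr_of_color_col b0 a i vd) E nbr_of_color_col.
exists [seq nbr_of_color b0 d a j | j <- enum color]; split.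
- by rewrite size_map size_enum_ord.
- by rewrite map_inj_uniq ?enum_uniq.
move=> b; case: (boolP (b \in d.1 a)) => ib.
  have [ic cc] := coding_of_step vd ib;
    rewrite -{2}(nbr_of_color_uniq b0 vd ib erefl) next_ord //.
  by symmetry; apply: nbr_of_color_uniq.
rewrite coding_of_out // next_nth; case: ifP => // /mapP[i _ E].
by rewrite E nbr_of_color_inc in ib.
Qed.

(** Along the cyclic order of a black vertex colors increase by 1, so that one
    color determines all the others by connectedness. *)
Lemma coding_of_inj d d' y : valid d -> valid d' -> coding_of d
  = coding_of d' ->
  d.2 y = d'.2 y -> d = d'.
Proof.
move=> vd vd' E ey.
have eI a b : (b \in d.1 a) = (b \in d'.1 a).
  by rewrite -(coding_of_moves k0 _ _ vd) E coding_of_moves.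
have step a b b' : b \in d.1 a -> b' \in d.1 a -> d.2 b = d'.2 b ->
    d.2 b' = d'.2 b'.
  move=> ib ib' eb; pose n := val (d.2 b' - d.2 b).
  have nE : inZp n = d.2 b' - d.2 b by rewrite /n valZpK.
  have [jn jc] := iter_coding_of n vd ib.
  have [_ jc'] := @iter_coding_of k A B d' a b n vd' (etrans (esym
    (eI a b)) ib).
  have E1 : iter n (coding_of d a) b = b'.
    rewrite -(nbr_of_color_uniq b vd jn jc); apply: nbr_of_color_uniq => //.
    by rewrite nE addrC subrK.
  by rewrite -E E1 -eb in jc'; rewrite jc' nE addrC subrK.
have td := vd.1.
pose f (v : A + B) := match v with
  | inl a => [forall b in d.1 a, d.2 b == d'.2 b]
  | inr b => d.2 b == d'.2 b end.
have fT : f =1 xpredT.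
  apply: (tree_constant td (r := inr y)) => [[a|b] [a'|b'] //= ib|];
    last exact/eqP.
    by move/forall_inP/(_ _ ib)/eqP->; rewrite eqxx.
  by move=> /eqP eb; apply/forall_inP=> b' ib'; apply/eqP; apply: (step a' b).
rewrite [d]surjective_pairing [d']surjective_pairing; congr pair.
  by apply/ffunP=> a; apply/setP=> b; apply: eI.
by apply/ffunP=> b; have /eqP := fT (inr b).
Qed.

(** The positions in the cyclic orders are the differences of a potential,
    whose values at the white vertices are the colors. *)
Lemma coding_of_surj c y : coding_tree k c ->
  exists2 d : colored_tree, valid d & coding_of d = c /\ d.2 y = 0.
Proof.
move=> [hc tc]; pose sq a := sval (cid (hc a)).
have sqP a : [/\ size (sq a) = k.+1, uniq (sq a) & c a =1 next (sq a)].
  exact: (svalP (cid (hc a))).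
pose w (u v : A + B) : color := match u, v with
  | inl a, inr b => inZp (index b (sq a))
  | inr b, inl a => - inZp (index b (sq a)) | _, _ => 0 end.
have wN u v : w u v = - w v u.
  by case: u v => [a|b] [a'|b'] /=; rewrite ?opprK ?oppr0.
have [f [fy fw]] := tree_potential tc (inr y) wN.
pose I := [ffun a => [set b in sq a]].
pose d : colored_tree := (I, [ffun b => f (inr b)]).
have nx a b : b \in sq a -> next (sq a) b \in sq a /\
    (inZp (index (next (sq a) b) (sq a)) : color)
    = inZp (index b (sq a)) + inZp 1.
  have [sz us _] := sqP a; move=> bs; rewrite mem_next; split=> //.
  rewrite (next_nth_mod b bs) index_uniq ?sz ?ltn_pmod //.
  by apply: val_inj; rewrite /= modn_mod modnDm addn1.
have mv a b : (c a b != b) = (b \in sq a).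
  have [sz us ->] := sqP a; case: (boolP (b \in sq a)) => bs; last first.
    by rewrite next_nth (negPf bs) eqxx.
  apply/eqP=> E; have [_ /eqP] := nx a b bs; rewrite E eq_sym.
  by rewrite (negPf (addr1_neq k0 _)).
have cI a b : b \in sq a -> d.2 b = f (inl a) + inZp (index b (sq a)).
  by move=> bs; rewrite ffunE (fw (inl a) (inr b)) //= mv.
have vd : valid d.
  split=> [|a].
    suff -> : inc_adj d.1 = coding_adj c by [].
    by apply/funext=> -[a|b]; apply/funext=> -[a'|b'] //=; rewrite ffunE inE mv.
  have [sz us _] := sqP a; split; first by rewrite ffunE cardsE (card_uniqP us).
  move=> b b'; rewrite ffunE !inE => bs bs';
    rewrite (cI a b) // (cI a b') // => /addrI/(congr1 val) /=.
  rewrite !modn_small -?sz ?index_mem // => E.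
  by rewrite -(nth_index b bs) E nth_index.
exists d => //; split; last by rewrite ffunE.
apply/ffunP=> a; apply/ffunP=> b; have [sz us ->] := sqP a.
case: (boolP (b \in sq a)) => bs;
  last by rewrite coding_of_out ?next_nth ?(negPf bs) // ffunE inE.
have ib : b \in d.1 a by rewrite ffunE inE.
have [nb1 nb2] := nx a b bs; have [ic cc] := coding_of_step vd ib.
apply: (vd.2 a).2 => //; first by rewrite ffunE inE.
by rewrite cc (cI a b) // (cI a (next _ b)) // nb2 addrA.
Qed.

Lemma relabel_coding_of (mu : {perm A}) (nu : {perm B}) d : valid d ->
  relabel_coding mu nu (coding_of d) = coding_of (relabel_tree mu nu d).
Proof.
move=> vd; apply/ffunP=> a; apply/ffunP=> b; rewrite 2!ffunE.
rewrite -{2}(permKV mu a) -{2}(permKV nu b).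
move: ((mu^-1)%g a) ((nu^-1)%g b) => {}a {}b.
have vr := valid_relabel_tree mu nu vd.
case: (boolP (b \in d.1 a)) => ib;
  last by rewrite !coding_of_out // relabel_tree_inc.
have [ic cc] := coding_of_step vd ib.
have ib' : nu b \in (relabel_tree mu nu d).1 (mu a) by rewrite relabel_tree_inc.
have [ic' cc'] := coding_of_step vr ib'.
apply: (vr.2 (mu a)).2 => //; first by rewrite relabel_tree_inc.
by rewrite cc' !relabel_tree_col.
Qed.

(** ** The action is a recoloring *)

(** Both kinds of roots are treated at once. For a black root [x] the white end
    [y] of the root edge has color 0; for a white root [y] the permutation
    fixes the color 0 of [y]. *)
Section Action.
Variables (root : A + B) (y : B) (d : colored_tree) (s : 'S_k.+1).
Hypothesis vd : valid d.
Hypothesis y0 : d.2 y = 0.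
Hypothesis rootP : match root with
  inl x => is_true (y \in d.1 x) | inr b => b = y /\ s 0 = 0 end.

Local Notation c := (coding_of d).
Local Notation l a := (d.2 (last_nbr root y c a)).
Local Notation par := (parent (coding_adj c) root).

Let adjE : coding_adj c = inc_adj d.1. Proof. exact: coding_of_adj. Qed.
Let tc : is_tree (coding_adj c). Proof. by rewrite adjE; case: vd. Qed.

Lemma last_nbr_root a : inl a = root -> last_nbr root y c a = y.
Proof. by move=> ar; rewrite /last_nbr -ar parent_root. Qed.

Lemma last_nbr_inc a : last_nbr root y c a \in d.1 a.
Proof.
have [ar|ar] := eqVneq (inl a) root.
  by rewrite last_nbr_root //; move: rootP; rewrite -ar.
have [u E] := parent_some tc ar; have := parent_adj tc E.
by rewrite /last_nbr E adjE; case: u {E}.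
Qed.

Lemma nbrP a i : nbr root y c a i \in d.1 a /\ d.2 (nbr root y c a i) = l a + i.
Proof.
by have := iter_coding_of i vd (last_nbr_inc a); rewrite valZpK; apply.
Qed.

Lemma positionE a b : b \in d.1 a -> position k root y c a b = d.2 b - l a.
Proof.
move=> ib; rewrite /position; case: pickP =>
  [i /eqP<-|/(_ (d.2 b - l a))/eqP[]].
  by rewrite (nbrP a i).2 addrC addKr.
have [ni nc] := nbrP a (d.2 b - l a).
by rewrite -(nbr_of_color_uniq b vd ni nc); apply: nbr_of_color_uniq => //;
  rewrite addrC subrK.
Qed.

(* The new color of the white vertex in position 0 at [a]. *)
Let kappa a : color := if inl a == root then 0 else s (l a).

(** Since rho_j (rho_i s) = rho_(i + j) s, the permutations met on the way from
    the root compose to rho_l s, where l is the color of the parent of [a].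
    Only a black root keeps [s] itself instead of rho_0 s, hence [kappa]. *)
Lemma local_permE a i :
  local_perm root y c #|A| s a i = s (l a + i) - kappa a.
Proof.
have [h [hlt _]] := parent_height tc root.
pose below a := [set a' : A | (h (inl a') < h (inl a))%N].
(* The recursion stops at black vertices with no black vertex above them. *)
have top : forall a i,
    (if par (inl a) is Some (inr p) then par (inr p) = None else True) ->
    s i = s (l a + i) - kappa a.
  move=> {}a {}i; case E: (par (inl a)) => [[a'|p]|] H.
  - by have := parent_adj tc E.
  - have pr : inr p = root.
      by apply/eqP; apply: contraT => /(parent_some tc)[u]; rewrite H.
    have [py s0] : p = y /\ s 0 = 0 by move: rootP; rewrite -pr.
    have -> : l a = 0 by rewrite /last_nbr E py.
    have -> : kappa a = 0 by rewrite /kappa /last_nbr E py y0 s0 if_same.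
    by rewrite add0r subr0.
  have ar : inl a = root.
    by apply/eqP; apply: contraT => /(parent_some tc)[u]; rewrite E.
  by rewrite /kappa ar eqxx last_nbr_root // y0 add0r subr0.
have main : forall n a i, (#|below a| <= n)%N ->
    local_perm root y c n s a i = s (l a + i) - kappa a;
      last exact/main/max_card.
move=> n; elim: n => [|n IH] {}a {}i ba /=.
  apply: top; case E: (par (inl a)) => [[a'|p]|] //.
  case E': (par (inr p)) => [[a'|b']|] //; last by have := parent_adj tc E'.
  have := hlt _ _ E; have /ltn_trans/[apply] := hlt _ _ E' => lt.
  move: ba; rewrite leqn0 cards_eq0 => /eqP/setP/(_ a').
  by rewrite !inE lt.
case E: (par (inl a)) => [[a'|p]|]; try by apply: top; rewrite E.
case E': (par (inr p)) => [[a'|b']|]; last by apply: top; rewrite E.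
  have lt : (h (inl a') < h (inl a))%N := ltn_trans (hlt _ _ E') (hlt _ _ E).
  have ip : p \in d.1 a' by have := parent_adj tc E'; rewrite adjE.
  have le : (#|below a'| <= n)%N.
    rewrite -ltnS; apply: leq_trans ba; apply: proper_card; apply/properP;
      split.
      by apply/fintype.subsetP=> a''; rewrite !inE => /ltn_trans; apply.
    by exists a'; rewrite !inE ?ltnn.
  have ar : inl a != root by apply/eqP=> ar; rewrite ar parent_root in E.
  rewrite permE !IH // positionE // /kappa
    (negPf ar) [last_nbr _ _ _ a]/last_nbr E.
  by rewrite opprB addrA subrK addrA [l a' + (_ - _)]addrC subrK.
by have := parent_adj tc E'.
Qed.

Lemma new_nbrP a i : new_nbr root y c s a i \in d.1 a /\
  s (d.2 (new_nbr root y c s a i)) = kappa a + i.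
Proof.
rewrite /new_nbr; set j := (_ i); have [ni ->] := nbrP a j; split=> //.
have E : i = s (l a + j) - kappa a by rewrite -local_permE permKV.
by rewrite [in RHS]E [RHS]addrC subrK.
Qed.

(** Position i at [a] goes to the white vertex of new color [kappa a + i], so
    that the new cyclic order lists the neighbors of [a] by increasing new
    color. *)
Lemma act_coding_of : act_coding root y c s = coding_of (recolor s d).
Proof.
apply/ffunP=> a; apply/ffunP=> b; rewrite 2!ffunE.
have vr := valid_recolor s vd.
have fI : injective (new_nbr root y c s a).
  by move=> i j E; have [_] := new_nbrP a i;
    rewrite E (new_nbrP a j).2 => /addrI.
case: (boolP (b \in d.1 a)) => ib; last first.
  rewrite coding_of_out // next_nth; case: ifP => // /mapP[i _ E].
  by rewrite E (new_nbrP a i).1 in ib.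
have bE : b = new_nbr root y c s a (s (d.2 b) - kappa a).
  have [ni nc] := new_nbrP a (s (d.2 b) - kappa a).
  apply: (let: conj _ f := vd in (f a).2) => //.
  by apply: (@perm_inj _ s); rewrite nc addrC subrK.
rewrite {1}bE next_ord //; have [ic cc] := coding_of_step vr ib.
have [ni nc] := new_nbrP a (s (d.2 b) - kappa a + inZp 1).
apply: (vr.2 a).2 => //.
by rewrite cc !ffunE nc addrA [kappa a + _]addrC subrK.
Qed.

End Action.
End CodingTrees.

(** * The incidence tree of a k-tree *)

(** The vertex of highest rank on a cycle of length at least 3 has two
    neighbors on it of no higher rank. *)
Lemma rank_acyclic (T : finType) (e : rel T) (r : T -> nat) : symmetric e ->
  (forall x y z, e x y -> e x z -> r y <= r x -> r z <= r x -> y = z)%N ->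
  forall s : seq T, ucycle e s -> (size s <= 2)%N.
Proof.
move=> eC er [|x0 s0] // /andP[]; set s := x0 :: s0 => cs us.
have [x xs xmax] : exists2 x, x \in s & {in s, forall y, r y <= r x}%N.
  case: (@arg_maxnP _ x0 (fun x => x \in s) r (mem_head _ _)) => x xs xmax.
  by exists x.
rewrite leqNgt; apply/negP=> sz.
have [i p E] := rot_to xs.
move: cs us sz xmax; rewrite -(rot_cycle i) -(rot_uniq i) -(size_rot i).
move=> + + + xmax; have {}xmax : {in x :: p, forall y, r y <= r x}%N.
  by move=> y; rewrite -E mem_rot; apply: xmax.
rewrite {}E; case: p xmax => [|y [|z p]] //= xmax /and3P[xy yz zp].
rewrite rcons_path in zp; case/andP: zp => _; rewrite eC => lx.
move=> /and3P[_ + _] _; rewrite (er x y (last z p)) ?mem_last //.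
  by apply: xmax; rewrite !inE eqxx orbT.
by apply: xmax; rewrite in_cons (in_cons y) mem_last !orbT.
Qed.

Lemma extend_injection (V C : finType) (f g : V -> C) (Q : {set V}) :
  {in Q &, injective f} -> {in Q &, injective g} ->
  exists s : {perm C}, {in Q, forall v, g v = s (f v)}.
Proof.
move=> fI gI; suff [s sP] : exists s : {perm C},
    {in enum Q, forall v, g v = s (f v)}.
  by exists s => v vQ; apply: sP; rewrite mem_enum.
have : {in enum Q &, injective f} by move=> u v; rewrite !mem_enum; apply: fI.
have : {in enum Q &, injective g} by move=> u v; rewrite !mem_enum; apply: gI.
have := enum_uniq (mem Q); elim: (enum _) => [|v p IH] /=; first by exists 1%g.
move=> /andP[vp up] {}gI {}fI; have [||s sP] := IH up.
- by move=> x y xp yp; apply: gI; rewrite inE ?xp ?yp orbT.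
- by move=> x y xp yp; apply: fI; rewrite inE ?xp ?yp orbT.
exists (s * tperm (s (f v)) (g v))%g => u;
  rewrite permM inE => /orP[/eqP->|up'].
  by rewrite tpermL.
have uv : u != v by apply: contraNneq vp => <-.
have uS : u \in v :: p by rewrite inE up' orbT.
have vS : v \in v :: p by rewrite mem_head.
rewrite -(sP u up') tpermD //.
  by rewrite sP // eq_sym; apply: contra_neq uv => /perm_inj; apply: fI.
by rewrite eq_sym; apply: contra_neq uv; apply: gI.
Qed.

Lemma missing_color (V C : finType) (f : V -> C) (Q : {set V}) :
  (#|Q| < #|C|)%N -> exists i, i \notin f @: Q.
Proof.
move=> lt; apply/existsP; rewrite -negb_forall; apply: contraL lt => /forallP h.
rewrite -leqNgt; apply: leq_trans (leq_imset_card f Q).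
by rewrite -cardsT; apply: subset_leq_card; apply/fintype.subsetP=> i _;
  apply: h.
Qed.

Lemma missing_color_uniq (V : finType) k (f : V -> 'I_k.+1) (Q : {set V}) i j :
  {in Q &, injective f} -> #|Q| = k -> i \notin f @: Q -> j \notin f @: Q ->
  i = j.
Proof.
move=> fI cQ iQ jQ; have cf : #|f @: Q| = k by rewrite card_in_imset.
have /eqP/cards1P[z E] : #|~: (f @: Q)| = 1%N.
  by have := cardsC (f @: Q); rewrite cf card_ord => c; apply/(@addnI k);
    rewrite c addn1.
have missing w : w \notin f @: Q -> w = z.
  by move/setP/(_ w): E; rewrite !inE => -> /eqP.
by rewrite (missing i) // (missing j).
Qed.

Section KTree.
Variables (k : nat) (V : finType) (e : rel V).
Hypotheses (eC : symmetric e) (ei : irreflexive e).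

Lemma ktree_has_clique S : ktree_on k e S -> exists2 Q, clique e k Q & Q
  \subset S.
Proof.
elim=> [{}S cS|{}S Q v _ [P cP PS] _ _ _ _]; first by exists S.
by exists P => //; apply: (fintype.subset_trans PS); apply: finset.subsetUr.
Qed.

Lemma clique_extend (S Q : {set V}) v :
  v \notin S -> Q \subset S -> clique e k Q ->
  {in S, forall u, e v u = (u \in Q)} -> clique e k.+1 (v |: Q).
Proof.
move=> vS QS [cQ eQ] ev; have vQ : v \notin Q.
  by apply: contra vS; apply/fintype.subsetP.
have evQ : {in Q, forall u, e v u}.
  by move=> u uQ; rewrite ev ?uQ //; apply: (fintype.subsetP QS).
split; first by rewrite cardsU1 vQ cQ.
move=> x y; rewrite !inE => /orP[/eqP->|xQ] /orP[/eqP->|yQ].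
- by rewrite eqxx.
- by move=> _; apply: evQ.
- by rewrite eC => _; apply: evQ.
exact: eQ.
Qed.

(** The vertex [v] is joined to [Q] only, so the cliques that it creates all
    lie in the new hedron. *)
Lemma clique_new (S Q : {set V}) v j N :
  {in S, forall u, e v u = (u \in Q)} -> clique e j N -> N \subset v |: S ->
  v \in N -> N \subset v |: Q.
Proof.
move=> ev [_ eN] NS vN; apply/fintype.subsetP=> u uN; rewrite !inE.
have [//|uv] := eqVneq u v; rewrite -ev /=.
  by rewrite eC; apply: eN.
by have := fintype.subsetP NS u uN; rewrite !inE (negPf uv).
Qed.

Lemma ktree_coloring S : ktree_on k e S ->
  exists f : V -> 'I_k.+1, {in S &, forall u v, e u v -> f u != f v}.
Proof.
elim=> [{}S [cS _]|{}S Q v _ [f fP] vS QS [cQ _] ev].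
  exists (fun u => inord (index u (enum S))) => u v uS vS uv.
  have iS w : w \in S -> (index w (enum S) < k.+1)%N.
    by move=> wS; rewrite ltnS ltnW // -[X in
      (_ < X)%N]cS cardE index_mem mem_enum.
  apply: contraTneq uv => /(congr1 val) /=; rewrite !inordK ?iS // => E.
  by rewrite -(nth_index u (s := enum S) (x := u)) ?mem_enum // E
    nth_index ?mem_enum // ei.
have [i iQ] : exists i, i \notin f @: Q.
  by apply: missing_color; rewrite cQ card_ord.
exists (fun u => if u == v then i else f u) => x y.
have new u : u \in S -> e v u -> i != f u.
  move=> uS; rewrite ev // => uQ; apply: contra iQ => /eqP->.
  exact: imset_f.
rewrite !inE; case: eqVneq => [->|xv] /=; case: eqVneq => [->|yv] //=.
- by rewrite ei.
- by move=> _; apply: new.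
- by move=> xS _; rewrite eC eq_sym; apply: new.
exact: fP.
Qed.

Lemma coloring_uniq (f g : V -> 'I_k.+1) S :
  (forall u v, e u v -> f u != f v) -> (forall u v, e u v -> g u != g v) ->
  ktree_on k e S -> exists s : 'S_k.+1, {in S, forall v, g v = s (f v)}.
Proof.
move=> fP gP; have clI (h : V -> 'I_k.+1) : (forall u v, e u v -> h u != h v) ->
    forall j Q, clique e j Q -> {in Q &, injective h}.
  move=> hP j Q [_ eQ] u v uQ vQ huv; apply/eqP; apply: contraTT isT => uv.
  by have := hP _ _ (eQ _ _ uQ vQ uv); rewrite huv eqxx.
elim=> [{}S cS|{}S Q v kS [s sP] vS QS cQ ev].
  by apply: extend_injection; apply: clI cS.
exists s => u; rewrite !inE => /orP[/eqP->{u}|/sP//].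
have QsP u : u \in Q -> g u = s (f u) by move=> uQ;
  rewrite sP // (fintype.subsetP QS).
have evQ u : u \in Q -> e v u by move=> uQ; rewrite ev // (fintype.subsetP QS).
apply: (missing_color_uniq (clI g gP k Q cQ) cQ.1).
  by apply/imsetP=> -[u /evQ /gP uQ E]; rewrite E eqxx in uQ.
apply/imsetP=> -[u uQ]; rewrite QsP // => /perm_inj E.
by have := fP _ _ (evQ u uQ); rewrite E eqxx.
Qed.

End KTree.

Definition node (A B : finType) (V : finType) (hed : A -> {set V})
    (fr : B -> {set V}) (v : A + B) : {set V} :=
  match v with inl a => hed a | inr b => fr b end.

Definition incidence (A B : finType) (V : finType) (hed : A -> {set V})
    (fr : B -> {set V}) : {ffun A -> {set B}} :=
  [ffun a => [set b | fr b \subset hed a]].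

Section LabeledKTree.
Variables (k : nat) (A B V : finType) (e : rel V).
Variables (hed : A -> {set V}) (fr : B -> {set V}).
Hypotheses (k0 : (0 < k)%N) (eC : symmetric e) (ei : irreflexive e).
Hypotheses (hedI : injective hed) (frI : injective fr).
Hypothesis hedP : forall H, clique e k.+1 H <-> (exists a, hed a = H).
Hypothesis frP : forall Q, clique e k Q <-> (exists b, fr b = Q).

Local Notation nd := (node hed fr).
Local Notation I := (incidence hed fr).

Lemma hed_clique a : clique e k.+1 (hed a).
Proof. by apply/hedP; exists a. Qed.

Lemma fr_clique b : clique e k (fr b).
Proof. by apply/frP; exists b. Qed.

Lemma incE a b : (b \in I a) = (fr b \subset hed a).
Proof. by rewrite ffunE inE. Qed.

Lemma node_clique x : exists j, clique e j (nd x).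
Proof. by case: x => [a|b]; [exists k.+1; apply: hed_clique|exists k;
  apply: fr_clique]. Qed.

Lemma hed_in_card a (S : {set V}) : #|S| = k.+1 -> hed a \subset S -> hed a = S.
Proof. by move=> cS aS; apply/eqP;
  rewrite eqEcard aS cS (hed_clique a).1 leqnn. Qed.

Lemma fr_in_card b (S : {set V}) : #|S| = k -> fr b \subset S -> fr b = S.
Proof. by move=> cS aS; apply/eqP;
  rewrite eqEcard aS cS (fr_clique b).1 leqnn. Qed.

Lemma no_hed a (S : {set V}) : #|S| = k -> hed a \subset S = false.
Proof.
by move=> cS; apply/negP=> /subset_leq_card; rewrite (hed_clique a).1 cS ltnn.
Qed.

Definition star (U : {set V}) : rel (A + B) :=
  [rel x y | [&& inc_adj I x y, U \subset nd x & U \subset nd y]].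

Lemma star_sym U : connect_sym (star U).
Proof.
apply: sym_connect_sym => x y; rewrite /star /= [X in _ && X]andbC; congr andb.
by case: x y => [a|b] [a'|b'].
Qed.

(** A new vertex [v] only creates cliques inside the new hedron, which is
    adjacent to the front [Q] to which [v] was attached; [Q] contains [U]
    unless [U] contains [v]. For [U] empty this is the connectedness of the
    incidence graph, for a singleton that of the cliques around a vertex. *)
Lemma star_connected S (U : {set V}) x y : ktree_on k e S ->
  U \subset nd x -> U \subset nd y -> nd x \subset S -> nd y \subset S ->
  connect (star U) x y.
Proof.
move=> kS; elim: kS x y => [{}S cS x y _ _|{}S Q v kS IH vS QS cQ ev x y].
  case: x => [a|b] /=; first by rewrite (no_hed _ cS.1).
  case: y => [a|b'] /=; first by rewrite (no_hed _ cS.1).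
  by move=> /(fr_in_card cS.1) E /(fr_in_card cS.1); rewrite -E => /frI->.
have [h hE] : exists a, hed a = v |: Q by apply/hedP; apply: clique_extend ev.
have [q qE] : exists b, fr b = Q by apply/frP.
have ch : #|v |: Q| = k.+1 by rewrite -hE; case: (hed_clique h).
have toh z : U \subset nd z -> nd z \subset v |: S -> v \in nd z ->
    U \subset hed h /\ connect (star U) z (inl h).
  move=> Uz zS vz; have [j cz] := node_clique z.
  have zh : nd z \subset hed h by rewrite hE; apply: clique_new cz zS vz.
  have Uh := fintype.subset_trans Uz zh; split=> //.
  case: z Uz zh {zS vz cz} => [a|b] /= Uz zh.
    by rewrite hE in zh; rewrite (hedI (etrans (hed_in_card ch zh) (esym hE))).
  by apply: connect1; rewrite /star /= incE Uz Uh zh.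
have old z : nd z \subset v |: S -> v \notin nd z -> nd z \subset S.
  move=> zS vz; apply/fintype.subsetP=> u uz.
  have := fintype.subsetP zS u uz; rewrite !inE => /orP[/eqP E|//].
  by rewrite E (negPf vz) in uz.
have [vU|vU] := boolP (v \in U).
  move=> Ux Uy xS yS.
  have [_ cx] := toh x Ux xS (fintype.subsetP Ux v vU).
  have [_] := toh y Uy yS (fintype.subsetP Uy v vU).
  by rewrite star_sym; apply: connect_trans.
have down z : U \subset nd z -> nd z \subset v |: S ->
    exists z', [/\ U \subset nd z', nd z' \subset S & connect (star U) z z'].
  move=> Uz zS; have [vz|vz] := boolP (v \in nd z); last first.
    by exists z; split=> //; apply: old.
  have [Uh zh] := toh z Uz zS vz.
  have UQ : U \subset Q.
    apply/fintype.subsetP=> u uU; have := fintype.subsetP Uh u uU.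
    by rewrite hE !inE => /orP[/eqP E|//]; rewrite E (negPf vU) in uU.
  exists (inr q); rewrite /= qE; split=> //; apply: connect_trans zh _.
  by apply: connect1; rewrite /star /= incE hE qE finset.subsetUr UQ -hE Uh.
move=> Ux Uy xS yS; have [x' [Ux' xS' cx]] := down x Ux xS.
have [y' [Uy' yS']] := down y Uy yS; rewrite star_sym.
by apply: connect_trans; apply: connect_trans cx _; apply: IH.
Qed.

(** Later cliques rank higher, and the new hedron ranks below the new fronts
    that it contains: then only the front [Q] to which the vertex was attached
    is a neighbor of the new hedron of lower rank, and this hedron is the only
    neighbor of a new front. *)
Lemma node_rank S : ktree_on k e S -> exists r : A + B -> nat, forall x y z,
  nd x \subset S -> nd y \subset S -> nd z \subset S ->
  inc_adj I x y -> inc_adj I x z -> (r y <= r x)%N -> (r z <= r x)%N -> y = z.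
Proof.
elim=> [{}S cS|{}S Q v kS [r IH] vS QS cQ ev].
  exists (fun _ => 0%N) => x y z xS yS zS.
  by case: x y xS yS => [a|b] [a'|b'] /=; rewrite ?(no_hed _ cS.1).
have [h hE] : exists a, hed a = v |: Q by apply/hedP; apply: clique_extend ev.
have ch : #|v |: Q| = k.+1 by rewrite -hE; case: (hed_clique h).
have toh z : nd z \subset v |: S -> ~~ (nd z \subset S) -> nd z \subset hed h.
  move=> zS nzS; have [j cz] := node_clique z; rewrite hE.
  apply: (clique_new _ ev cz zS) => //; apply: contraR nzS => vz.
  apply/fintype.subsetP=> u uz; have := fintype.subsetP zS u uz.
  by rewrite !inE => /orP[/eqP E|//]; rewrite E (negPf vz) in uz.
have newh a : hed a \subset v |: S -> ~~ (hed a \subset S) -> a = h.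
  move=> aS naS; have := toh (inl a) aS naS;
    rewrite /= hE => /(hed_in_card ch) E.
  by apply: hedI; rewrite E hE.
pose M := (\max_x r x)%N; have rM x : (r x <= M)%N by apply: leq_bigmax.
pose r' x := if nd x \subset S then r x else if x is inl _ then M.+1 else M.+2.
have r'M x : ~~ (nd x \subset S) -> (M < r' x)%N.
  by rewrite /r' => /negPf->; case: x.
exists r' => x y z xS yS zS xy xz.
have [xS'|nxS] := boolP (nd x \subset S).
  have r'x : r' x = r x by rewrite /r' xS'.
  have old w : (r' w <= r' x)%N -> nd w \subset S /\ r' w = r w.
    rewrite r'x => wx; have wS : nd w \subset S.
      by apply: contraLR wx => /r'M lt; rewrite -ltnNge;
        apply: leq_ltn_trans lt.
    by rewrite /r' wS.
  move=> yx zx; have [yS' Ey] := old y yx; have [zS' Ez] := old z zx.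
  by rewrite r'x Ey in yx; rewrite r'x Ez in zx; apply: IH xy xz yx zx.
case: x xS nxS xy xz => [a|b] xS nxS xy xz.
  case: y xy yS => // b yb yS; case: z xz zS => // b' zb zS.
  have r'a : r' (inl a) = M.+1 by rewrite /r' (negPf nxS).
  have old c : (r' (inr c) <= M.+1)%N -> c \in I a -> fr c = Q.
    move=> lt; rewrite incE (newh _ xS nxS) hE => cQ'.
    apply: fr_in_card; first by case: cQ.
    apply/fintype.subsetP=> u uc; have := fintype.subsetP cQ' u uc.
    rewrite !inE => /orP[/eqP E|//]; move: lt; rewrite /r' /=.
    rewrite ifF ?ltnn //; apply/negP=> cS; rewrite -E in vS.
    by rewrite (fintype.subsetP cS u uc) in vS.
  rewrite r'a => /old/(_ yb) E /old/(_ zb) E'.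
  by congr inr; apply: frI; rewrite E E'.
case: y xy yS => // a ya yS; case: z xz zS => // a' za zS _ _.
have sub c : b \in I c -> ~~ (hed c \subset S).
  by rewrite incE => bc; apply: contra nxS; apply: fintype.subset_trans.
by rewrite (newh a yS (sub a ya)) (newh a' zS (sub a' za)).
Qed.

Lemma incidence_tree : ktree_on k e [set: V] -> is_tree (inc_adj I).
Proof.
move=> kV; have Ie : symmetric (inc_adj I) by case=> [a|b] [a'|b'].
split=> //.
- have [Q /frP[b _] _] := ktree_has_clique kV.
  by apply/card_gt0P; exists (inr b).
- by case.
- move=> x y; have := @star_connected _ finset.set0 x y kV;
  rewrite !finset.sub0set !finset.subsetT.
  move=> /(_ isT isT isT isT); apply: connect_sub => u w /and3P[uw _ _].
  exact: connect1.
have [r rP] := node_rank kV; apply: (@rank_acyclic _ _ r) => // x y z.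
by apply: rP; rewrite finset.subsetT.
Qed.

Lemma ktree_cover v : ktree_on k e [set: V] -> exists b, v \in fr b.
Proof.
move=> kV; have : v \in [set: V] by rewrite inE.
elim: kV => [S cS vS|S Q w _ IH wS QS cQ ev].
  by have [b E] := (frP S).1 cS; exists b; rewrite E.
rewrite !inE => /orP[/eqP->|/IH//].
have [q qQ] : exists q, q \in Q by apply/card_gt0P; rewrite cQ.1.
have [cQ' eQ'] := clique_extend eC wS QS cQ ev.
have qw : q != w by apply: contraNneq wS => <-; apply: (fintype.subsetP QS).
have [b E] : exists b, fr b = (w |: Q) :\ q.
  apply/frP; split.
    by have := cardsD1 q (w |: Q); rewrite cQ' !inE qQ orbT add1n => -[].
  by move=> x y /setD1P[_ x1] /setD1P[_ y1]; apply: eQ'.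
by exists b; rewrite E !inE eqxx eq_sym qw.
Qed.

Lemma ktree_edge u v : ktree_on k e [set: V] -> e u v ->
  exists x, (u \in nd x) && (v \in nd x).
Proof.
move=> kV; have : v \in [set: V] by rewrite inE.
have : u \in [set: V] by rewrite inE.
elim: kV => [S cS uS vS _|S Q w _ IH wS QS cQ ev].
  by have [b E] := (frP S).1 cS; exists (inr b); rewrite /= E uS.
have [h hE] : exists a, hed a = w |: Q by apply/hedP; apply: clique_extend ev.
rewrite !inE => /orP[/eqP->|uS] /orP[/eqP->|vS].
- by rewrite ei.
- by rewrite ev // => vQ; exists (inl h); rewrite /= hE !inE eqxx vQ orbT.
- by rewrite eC ev // => uQ; exists (inl h); rewrite /= hE !inE eqxx uQ orbT.
exact: IH.
Qed.

End LabeledKTree.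

(** * Colored trees of a k-tree *)

Definition proper_coloring (k : nat) (V : finType) (e : rel V)
    (f : V -> 'I_k.+1) : Prop := forall u v, e u v -> f u != f v.

Definition ktree_model (k : nat) (A B V : finType) (e : rel V)
    (hed : A -> {set V}) (fr : B -> {set V}) : Prop :=
  [/\ symmetric e, irreflexive e & ktree_on k e [set: V]] /\
  [/\ injective hed,
      forall H, clique e k.+1 H <-> (exists a, hed a = H),
      injective fr
    & forall Q, clique e k Q <-> (exists b, fr b = Q)].

Definition encodes (k : nat) (A B V : finType) (hed : A -> {set V})
    (fr : B -> {set V}) (f : V -> 'I_k.+1) (d : colored_tree k A B) : Prop :=
  d.1 = incidence hed fr /\ forall b, d.2 b \notin f @: fr b.

Section Transport.
Variables (V W : finType) (e : rel V) (e' : rel W) (g : V -> W).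
Hypotheses (gI : injective g) (ge : forall u v, e' (g u) (g v) = e u v).

Lemma clique_inj j (Q : {set V}) : clique e' j (g @: Q) <-> clique e j Q.
Proof.
rewrite /clique (card_imset _ gI); split=> -[cQ eQ]; split=> //.
  move=> u v uQ vQ uv; rewrite -ge; apply: eQ; rewrite ?imset_f //.
  by rewrite (inj_eq gI).
move=> _ _ /imsetP[u uQ ->] /imsetP[v vQ ->]; rewrite (inj_eq gI) ge.
exact: eQ.
Qed.

Lemma ktree_on_inj k (S : {set V}) : ktree_on k e S -> ktree_on k e' (g @: S).
Proof.
elim=> [{}S cS|{}S Q v _ IH vS QS cQ ev]; first by apply: ktree_complete;
  apply/clique_inj.
rewrite imsetU1; apply: (ktree_extend (Q := g @: Q)) => //.
- by rewrite mem_imset.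
- exact: imsetS.
- exact/clique_inj.
by move=> _ /imsetP[u uS ->]; rewrite ge mem_imset // ev.
Qed.

Lemma incidence_inj (A B : finType) (hed : A -> {set V}) (fr : B -> {set V}) :
  incidence (fun a => g @: hed a) (fun b => g @: fr b) = incidence hed fr.
Proof.
apply/ffunP=> a; apply/setP=> b; rewrite !incE.
apply/fintype.subsetP/fintype.subsetP => [sub v vb|sub _ /imsetP[v vb ->]].
  by rewrite -(mem_imset _ _ gI); apply: sub; apply: imset_f.
exact/imset_f/sub.
Qed.

Lemma ktree_model_bij k (A B : finType) (hed : A -> {set V}) (fr :
  B -> {set V}) :
  bijective g -> ktree_model k e hed fr ->
  ktree_model k e' (fun a => g @: hed a) (fun b => g @: fr b).
Proof.
move=> [h gK hK] [[eC ei kV] [hI hP fI fP]].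
have preim (S : {set W}) : g @: (g @^-1: S) = S.
  by apply/setP=> w; rewrite -(hK w) mem_imset // inE.
split; split.
- by move=> x y; rewrite -(hK x) -(hK y) !ge.
- by move=> x; rewrite -(hK x) ge.
- by rewrite -(preim [set: W]) preimsetT; apply: ktree_on_inj.
- by move=> a a' /(imset_inj gI)/hI.
- move=> H; rewrite -(preim H) clique_inj hP.
  by split=> -[a E]; exists a; [rewrite E|apply: (imset_inj gI)].
- by move=> b b' /(imset_inj gI)/fI.
move=> H; rewrite -(preim H) clique_inj fP.
by split=> -[a E]; exists a; [rewrite E|apply: (imset_inj gI)].
Qed.

End Transport.

Section Encoding.
Variables (k : nat) (A B : finType).
Local Notation color := 'I_k.+1.
Local Notation colored_tree := (colored_tree k A B).

Section OneTree.
Variables (V : finType) (e : rel V) (hed : A -> {set V}) (fr : B -> {set V}).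
Hypothesis mV : ktree_model k e hed fr.

Lemma clique_rainbow (f : V -> color) j Q :
  proper_coloring e f -> clique e j Q -> {in Q &, injective f}.
Proof.
move=> fP [_ eQ] u v uQ vQ fuv; apply/eqP; apply: contraTT isT => uv.
by have := fP _ _ (eQ _ _ uQ vQ uv); rewrite fuv eqxx.
Qed.

Lemma hedron_color (f : V -> color) a i : proper_coloring e f ->
  exists2 v, v \in hed a & f v = i.
Proof.
have [_ [_ hP _ _]] := mV; move=> fP;
  have ca : clique e k.+1 (hed a) by apply/hP; exists a.
have : i \in f @: hed a.
  suff -> : f @: hed a = [set: color] by rewrite inE.
  apply/eqP; rewrite eqEcard finset.subsetT cardsT card_ord card_in_imset;
    first by rewrite ca.1 /=.
  exact: clique_rainbow ca.
by case/imsetP=> v va ->; exists v.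
Qed.

Lemma front_color (f : V -> color) (d : colored_tree) b i :
  proper_coloring e f ->
  encodes hed fr f d -> i != d.2 b -> exists2 v, v \in fr b & f v = i.
Proof.
have [_ [_ _ _ fP]] := mV; move=> pf [_ dc] ne.
have cb : clique e k (fr b) by apply/fP; exists b.
have [iF|iF] := boolP (i \in f @: fr b); first by case/imsetP: iF => v vb ->;
  exists v.
case/eqP: ne; apply: missing_color_uniq iF (dc b); last exact: cb.1.
exact: clique_rainbow cb.
Qed.

Lemma encoding_exists : exists (f : V -> color) (d : colored_tree),
  proper_coloring e f /\ encodes hed fr f d.
Proof.
have [[eC ei kV] [_ _ _ fP]] := mV; have [f pf] := ktree_coloring eC ei kV.
have ex b : exists i, i \notin f @: fr b.
  apply: missing_color; rewrite card_ord ltnS.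
  by have /fP[-> _] : exists b', fr b' = fr b by exists b.
exists f, (incidence hed fr, [ffun b => sval (cid (ex b))]); split.
  by move=> u v; apply: pf; rewrite inE.
by split=> // b; rewrite ffunE; apply: svalP (cid (ex b)).
Qed.

(** A front of the hedron [a] is the set of its vertices other than the one
    whose color is missing, so that colors tell the fronts of [a] apart. *)
Lemma encodes_valid (f : V -> color) (d : colored_tree) :
  proper_coloring e f -> encodes hed fr f d -> valid d.
Proof.
have [[eC ei kV] [hI hP fI fP]] := mV; move=> pf [dI dc]; split=> [|a].
  by rewrite dI; apply: incidence_tree hP fP kV.
have ca : clique e k.+1 (hed a) by apply/hP; exists a.
have face i b : b \in d.1 a -> d.2 b = i -> fr b = [set v in hed a | f v != i].
  rewrite dI incE => ba bi; apply/eqP; rewrite eqEcard; apply/andP; split.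
    apply/fintype.subsetP=> v vb; rewrite inE (fintype.subsetP ba) //=.
    by rewrite -bi; apply: contraNneq (dc b) => <-; apply: imset_f.
  have [v va fv] := hedron_color a i pf.
  have -> : #|fr b| = k by have /fP[-> _] : exists b', fr b' = fr b by exists b.
  have ck : #|hed a :\ v| = k by have := cardsD1 v (hed a);
    rewrite va ca.1 add1n => -[].
  apply: (@leq_trans #|hed a :\ v|); last by rewrite ck.
  apply: subset_leq_card; apply/fintype.subsetP=> u; rewrite !inE.
  by move=> /andP[-> fu]; rewrite andbT; apply: contraNneq fu => ->; rewrite fv.
have dI' : {in d.1 a &, injective d.2}.
  by move=> b b' ba ba' E; apply: fI;
    rewrite (face _ _ ba E) (face _ _ ba' erefl).
split=> //; rewrite -(card_in_imset dI') -[RHS]card_ord -cardsT.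
congr #|pred_of_set _|; apply/setP=> i; rewrite [RHS]inE; apply/imsetP.
have [v va fv] := hedron_color a i pf.
have [b bE] : exists b, fr b = hed a :\ v.
  apply/fP; split.
    by have := cardsD1 v (hed a); rewrite va ca.1 add1n => -[].
  by move=> x y /setD1P[_ xa] /setD1P[_ ya]; apply: ca.2.
exists b; first by rewrite dI incE bE subD1set.
apply/eqP; apply: contraT => /(front_color pf (conj dI dc))[u].
rewrite bE !inE => /andP[uv ua] fu; case/eqP: uv.
by apply: (clique_rainbow pf ca) => //; rewrite fu fv.
Qed.

(** The permutation relating the two colorings relates the missing colors. *)
Lemma encoding_uniq (f g : V -> color) (d d' : colored_tree) :
  proper_coloring e f -> encodes hed fr f d ->
  proper_coloring e g -> encodes hed fr g d' ->
  exists s : 'S_k.+1, d' = recolor s d.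
Proof.
have [[eC ei kV] [_ _ _ fP]] := mV; move=> pf [dI dc] pg [dI' dc'].
have [s sP] := coloring_uniq pf pg kV; exists s.
rewrite [d']surjective_pairing /recolor dI dI'; congr pair.
apply/ffunP=> b; rewrite ffunE; have cb : clique e k (fr b) by apply/fP;
  exists b.
apply: (missing_color_uniq (clique_rainbow pg cb) cb.1 (dc' b)).
apply: contra (dc b) => /imsetP[v vb]; rewrite sP ?inE // => /perm_inj ->.
exact: imset_f.
Qed.

Lemma encodes_recolor (f : V -> color) (d : colored_tree) (s : 'S_k.+1) :
  proper_coloring e f -> encodes hed fr f d ->
  proper_coloring e (s \o f) /\ encodes hed fr (s \o f) (recolor s d).
Proof.
move=> pf [dI dc]; split; first by move=> u v /pf; rewrite /= (inj_eq perm_inj).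
split=> // b; rewrite ffunE; apply: contra (dc b) => /imsetP[v vb /perm_inj ->].
exact: imset_f.
Qed.

End OneTree.

Section TwoTrees.
Variables (V W : finType) (e : rel V) (e' : rel W).
Variables (hed : A -> {set V}) (fr : B -> {set V}).
Variables (hed' : A -> {set W}) (fr' : B -> {set W}).
Variables (f : V -> color) (f' : W -> color) (d : colored_tree).
Hypothesis k0 : (0 < k)%N.
Hypotheses (mV : ktree_model k e hed fr) (mW : ktree_model k e' hed' fr').
Hypotheses (pf : proper_coloring e f) (pf' : proper_coloring e' f').
Hypotheses (ed : encodes hed fr f d) (ed' : encodes hed' fr' f' d).

Local Notation nd := (node hed fr).
Local Notation nd' := (node hed' fr').

(** Vertices of two k-trees with the same colored tree that an isomorphism
    compatible with the colors has to identify. *)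
Definition matches (v : V) (w : W) : Prop :=
  f v = f' w /\ exists x, v \in nd x /\ w \in nd' x.

Lemma matches_at x v : v \in nd x -> exists2 w, w \in nd' x & f v = f' w.
Proof.
case: x => [a|b] /= vx.
  by have [w wa <-] := hedron_color mW a (f v) pf'; exists w.
have [|w wb <-] := @front_color _ e' hed' fr' mW f' d b (f v) pf' ed';
  last by exists w.
by apply: contraNneq (ed.2 b) => <-; apply: imset_f.
Qed.

Lemma matches_total v : exists w, matches v w.
Proof.
have [[eC ei kV] [_ _ _ fP]] := mV; have [b vb] := ktree_cover k0 eC fP v kV.
by have [w wb fw] := @matches_at (inr b) v vb; exists w; split=> //;
  exists (inr b).
Qed.

Lemma node'_rainbow x : {in nd' x &, injective f'}.
Proof.
have [_ [_ hP _ fP]] := mW; case: x => [a|b] /=.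
  by apply: (@clique_rainbow _ e' f' k.+1) => //; apply/hP; exists a.
by apply: (@clique_rainbow _ e' f' k) => //; apply/fP; exists b.
Qed.

(** By [star_connected] the cliques through [v] are linked by a path of cliques
    through [v]. At each step the corresponding cliques of the second k-tree
    are nested, and each has exactly one vertex with the color of [v]. *)
Lemma matches_inj v w w' : matches v w -> matches v w' -> w = w'.
Proof.
have [[eC ei kV] [hI hP fI fP]] := mV.
move=> [fw [x [vx wx]]] [fw' [y [vy wy]]].
have := @star_connected k A B V e hed fr eC hI fI hP fP [set: V] [set v] x y kV.
rewrite !finset.sub1set vx vy !finset.subsetT =>
  /(_ isT isT isT isT)/connectP[p].
elim: p x vx w wx fw => [|z p IH] x vx w wx fw /=.
  by move=> _ E; rewrite E in wy; apply: (node'_rainbow wx wy); rewrite -fw.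
move=> /andP[/and3P[xz _]]; rewrite finset.sub1set => vz zp lz.
have [w2 w2z fw2] := matches_at vz.
apply: (IH z vz w _ fw zp lz); suff -> : w = w2 by [].
have adj' : nd' x \subset nd' z \/ nd' z \subset nd' x.
  case: x z xz {vx wx vz zp lz w2z} => [a|b] [a'|b'] //=.
    by rewrite -ed.1 ed'.1 incE; right.
  by rewrite -ed.1 ed'.1 incE; left.
case: adj' => /fintype.subsetP sub.
  by apply: (node'_rainbow (sub _ wx) w2z); rewrite -fw.
by apply: (node'_rainbow wx (sub _ w2z)); rewrite -fw.
Qed.

End TwoTrees.
End Encoding.

Section SameEncoding.
Variables (k : nat) (A B : finType) (d : colored_tree k A B).
Hypothesis k0 : (0 < k)%N.

Lemma same_encoding_iso (V W : finType) (e : rel V) (e' : rel W)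
    (hed : A -> {set V}) (fr : B -> {set V}) (hed' : A -> {set W})
    (fr' : B -> {set W}) (f : V -> 'I_k.+1) (f' : W -> 'I_k.+1) :
  ktree_model k e hed fr -> ktree_model k e' hed' fr' ->
  proper_coloring e f -> proper_coloring e' f' ->
  encodes hed fr f d -> encodes hed' fr' f' d ->
  exists phi : V -> W,
  [/\ bijective phi, forall v w, e' (phi v) (phi w) = e v w,
      forall a, hed' a = phi @: hed a & forall b, fr' b = phi @: fr b].
Proof.
move=> mV mW pf pf' ed ed'.
pose M := matches hed fr hed' fr' f f'.
have MC v w : matches hed' fr' hed fr f' f w v <-> M v w.
  by split=> -[E [x [vx wx]]]; split=> //; exists x.
have ex v := matches_total k0 mV mW pf' ed ed' v.
have ex' w := matches_total k0 mW mV pf ed' ed w.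
pose phi v := sval (cid (ex v)); pose psi w := sval (cid (ex' w)).
have phiM v : M v (phi v) by exact: svalP (cid (ex v)).
have psiM w : M (psi w) w by apply/MC; exact: svalP (cid (ex' w)).
have Minj v w w' : M v w -> M v w' -> w = w'.
  exact: (matches_inj mV mW pf' ed ed').
have Minj' v v' w : M v w -> M v' w -> v = v'.
  by move=> /MC h /MC; apply: (matches_inj mW mV pf ed' ed h).
have phiK : cancel phi psi by move=> v; apply: Minj' (psiM _) (phiM v).
have psiK : cancel psi phi by move=> w; apply: Minj (phiM _) (psiM w).
have phiI := can_inj phiK.
have nodeE x : node hed' fr' x = phi @: node hed fr x.
  apply/setP=> w; apply/idP/imsetP => [wx|[v vx ->]].
    have [v vx fv] := matches_at mV pf ed' ed wx.
    by exists v => //; apply: Minj (phiM v); split=> //; exists x.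
  have [w' wx fw] := matches_at mW pf' ed ed' vx.
  by rewrite (Minj v (phi v) w') //; split=> //; exists x.
exists phi; split.
- by exists psi.
- move=> v w; have [[eC ei kV] [_ hP _ fP]] := mV.
  have [[eC' ei' kW] [_ hP' _ fP']] := mW.
  have cl x : exists j, clique e j (node hed fr x)
    by apply: node_clique hP fP x.
  have cl' x : exists j, clique e' j (node hed' fr' x)
    by apply: node_clique hP' fP' x.
  apply/idP/idP => [vw|vw].
    have [x /andP[]] := ktree_edge eC' ei' hP' fP' kW vw.
    rewrite nodeE !mem_imset // => vx wx; have [j [_ ce]] := cl x;
      apply: ce => //.
    by apply: contraTneq vw => ->; rewrite ei'.
  have [x /andP[vx wx]] := ktree_edge eC ei hP fP kV vw.
  have [j [_ ce]] := cl' x; apply: ce;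
    rewrite ?nodeE ?imset_f ?(inj_eq phiI) //.
  by apply: contraTneq vw => ->; rewrite ei.
- by move=> a; apply: (nodeE (inl a)).
by move=> b; apply: (nodeE (inr b)).
Qed.

Definition represents (d : colored_tree k A B) (t : labeled_graph A B) : Prop :=
  labeled_ktree k t /\ exists f : 'I_(order_of t) -> 'I_k.+1,
    proper_coloring (adj t) f /\ encodes (hedron t) (front t) f d.

Lemma represents_same_iso t u : represents d t -> represents d u ->
  labeled_iso t u.
Proof.
by move=> [mt [f [pf ed]]] [mu [g [pg ed']]]; apply: same_encoding_iso ed ed'.
Qed.

Lemma represents_iso t u : represents d t -> labeled_iso t u ->
  represents d u.
Proof.
move=> [mt [f [pf [dI dc]]]] [phi [pb pe ph pr]].
have hE : (hedron u : A -> _) = fun a => phi @: hedron t a by apply/funext.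
have fE : (front u : B -> _) = fun b => phi @: front t b by apply/funext.
have [psi phiK psiK] := pb.
split.
  change (ktree_model k (adj u) (hedron u) (front u)); rewrite hE fE.
  exact: (ktree_model_bij (bij_inj pb) pe pb mt).
exists (f \o psi); split=> [x y|].
  by rewrite -{1}(psiK x) -{1}(psiK y) pe => /pf.
rewrite /encodes hE fE (incidence_inj (bij_inj pb)); split=> // b.
apply: contra (dc b) => /imsetP[_ /imsetP[v vb ->] ->].
by rewrite /= phiK imset_f.
Qed.

Lemma represents_valid t : represents d t -> valid d.
Proof. by move=> [mt [f [pf ed]]]; apply: encodes_valid mt f d pf ed. Qed.

Lemma represents_recolor s t : represents d t -> represents (recolor s d) t.
Proof.
move=> [mt [f [pf ed]]]; split=> //; exists (s \o f).
exact: encodes_recolor pf ed.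
Qed.

Lemma represents_uniq d' t : represents d t -> represents d' t ->
  exists s, d' = recolor s d.
Proof.
by move=> [mt [f [pf ed]]] [_ [g [pg ed']]];
  exact: (encoding_uniq (mt : ktree_model _ _ _ _) pf ed pg ed').
Qed.

Lemma represents_relabel (mu : {perm A}) (nu : {perm B}) t : represents d t ->
  represents (relabel_tree mu nu d) (relabel_graph mu nu t).
Proof.
move=> [[kt [hI hP fI fP]] [f [pf [dI dc]]]]; split.
  split=> //; split.
  - by move=> a a'; rewrite !ffunE => /hI/perm_inj.
  - move=> H; rewrite hP; split=> -[a <-].
      by exists (mu a); rewrite ffunE permK.
    by exists ((mu^-1)%g a); rewrite ffunE.
  - by move=> a a'; rewrite !ffunE => /fI/perm_inj.
  move=> H; rewrite fP; split=> -[a <-].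
    by exists (nu a); rewrite ffunE permK.
  by exists ((nu^-1)%g a); rewrite ffunE.
exists f; split=> //; split=> [|b]; last by rewrite /= !ffunE.
apply/ffunP=> a; apply/setP=> b;
  rewrite -(permKV mu a) -(permKV nu b) relabel_tree_inc.
by rewrite incE /= !ffunE !permK dI ffunE inE.
Qed.

End SameEncoding.

Lemma represents_exists (k : nat) (A B : finType) (t : labeled_graph A B) :
  labeled_ktree k t -> exists d : colored_tree k A B, represents d t.
Proof.
move=> mt; have [f [d [pf ed]]] := encoding_exists (mt : ktree_model _ _ _ _).
by exists d; split=> //; exists f.
Qed.

(** * Growing a k-tree along a colored tree *)

Section Growth.
Variables (k : nat) (A B : finType) (d : colored_tree k A B).
Hypothesis vd : valid d.
Local Notation color := 'I_k.+1.

(** A properly colored k-tree whose hedra and fronts are labeled by the black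
    vertices in [SA] and the white vertices in [SB] of [d] only. *)
Definition partial_model (SA : {set A}) (SB : {set B}) (V : finType)
    (e : rel V) (hed : A -> {set V}) (fr : B -> {set V}) (f : V -> color) :=
  [/\ symmetric e, irreflexive e & ktree_on k e [set: V]] /\
  [/\ {in SA &, injective hed},
      forall H, clique e k.+1 H <-> (exists2 a, a \in SA & hed a = H),
      {in SB &, injective fr}
    & forall Q, clique e k Q <-> (exists2 b, b \in SB & fr b = Q)] /\
  [/\ proper_coloring e f,
      {in SA & SB, forall a b, (b \in d.1 a) = (fr b \subset hed a)}
    & {in SB, forall b, d.2 b \notin f @: fr b}].

Section Extend.
Variables (SA : {set A}) (SB : {set B}) (V : finType) (e : rel V).
Variables (hed : A -> {set V}) (fr : B -> {set V}) (f : V -> color).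
Variables (a0 : A) (b0 : B).
Hypothesis mV : partial_model SA SB e hed fr f.
Hypothesis closed : forall a, a \in SA -> d.1 a \subset SB.
Hypotheses (a0N : a0 \notin SA) (b0S : b0 \in SB) (b0a : b0 \in d.1 a0).
Hypothesis b0u : forall b, b \in d.1 a0 -> b \in SB -> b = b0.

(** The vertex [None] is joined to the front [b0] to make the hedron [a0]. *)
Definition ext_adj : rel (option V) := fun u v =>
  match u, v with
  | Some x, Some y => e x y
  | None, Some x | Some x, None => x \in fr b0
  | None, None => false
  end.

(** The new vertex takes the color missing from [b0]. *)
Definition ext_color (u : option V) : color := oapp f (d.2 b0) u.

Let h : {set option V} := None |: Some @: fr b0.

Definition ext_hed (a : A) : {set option V} :=
  if a == a0 then h else Some @: hed a.

Let face i := [set u in h | ext_color u != i].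

Definition ext_fr (b : B) : {set option V} :=
  if b \in SB then Some @: fr b else face (d.2 b).

Let SI : injective (@Some V). Proof. exact: Some_inj. Qed.
Let SE (u v : V) : ext_adj (Some u) (Some v) = e u v. Proof. by []. Qed.

Let None_Some (Q : {set V}) : None \in Some @: Q = false.
Proof. by apply/negP=> /imsetP[]. Qed.

Let cb0 : clique e k (fr b0).
Proof. by have [_ [[_ _ _ fP] _]] := mV; apply/fP; exists b0. Qed.

Let eC' : symmetric ext_adj.
Proof. by have [[eC _ _] _] := mV; move=> [u|] [v|] //=; rewrite eC. Qed.

Let pf' : proper_coloring ext_adj ext_color.
Proof.
have [_ [_ [pf _ dc]]] := mV; have dc0 := dc b0 b0S.
have ne u : u \in fr b0 -> f u != d.2 b0.
  by move=> ub; apply: contraNneq dc0 => <-; apply: imset_f.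
move=> [u|] [v|] //=; [exact: pf|exact: ne|].
by rewrite eq_sym; apply: ne.
Qed.

Let N_adj : {in Some @: [set: V], forall u, ext_adj None u = (u \in Some @:
  fr b0)}.
Proof. by move=> _ /imsetP[u _ ->]; rewrite mem_imset. Qed.

Let ch : clique ext_adj k.+1 h.
Proof.
apply: (clique_extend eC' _ _ _ N_adj); rewrite ?None_Some //.
  by apply: imsetS; apply: finset.subsetT.
exact/(clique_inj SI SE).
Qed.

Let SomeT : None |: Some @: [set: V] = [set: option V].
Proof. by apply/setP=> -[u|]; rewrite !inE //= mem_imset // inE. Qed.

Let hI : {in h &, injective ext_color}.
Proof. exact: clique_rainbow pf' ch. Qed.

Let h_color i : exists2 u, u \in h & ext_color u = i.
Proof.
have : i \in ext_color @: h.
  suff -> : ext_color @: h = [set: color] by rewrite inE.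
  by apply/eqP; rewrite eqEcard finset.subsetT cardsT card_ord card_in_imset //
    ch.1 /=.
by case/imsetP=> u uh ->; exists u.
Qed.

Let faceE i u : u \in h -> ext_color u = i -> face i = h :\ u.
Proof.
move=> uh ui; apply/setP=> v; rewrite [LHS]inE [RHS]in_setD1 andbC.
have [vh|] := boolP (v \in h); rewrite ?andbF ?andbT //; congr negb.
by apply/eqP/eqP => [E|->//]; apply: hI; rewrite // ui.
Qed.

Let face_card i : #|face i| = k.
Proof.
have [u uh ui] := h_color i; rewrite (faceE uh ui).
by have := cardsD1 u h; rewrite uh ch.1 add1n => -[].
Qed.

Let face_clique i : clique ext_adj k (face i).
Proof.
split=> // u v; rewrite !inE -!in_setU1 => /andP[uh _] /andP[vh _]; exact: ch.2.
Qed.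

Let face_inj : injective face.
Proof.
move=> i j E; have [u uh ui] := h_color i; apply/eqP; apply: contraT => ij.
have : u \in face j by rewrite inE uh ui.
by rewrite -E inE ui eqxx andbF.
Qed.

Let None_face b : b \in d.1 a0 -> b \notin SB -> None \in face (d.2 b).
Proof.
move=> ba bS; rewrite !inE /=; apply/eqP=> E.
have [_ /(_ a0)[_ dI]] := vd.
by move: bS; rewrite -(dI _ _ b0a ba E) b0S.
Qed.

Let Some_cover (N : {set option V}) : None \notin N -> N = Some @: (Some @^-1:
  N).
Proof.
move=> NN; apply/setP=> -[u|]; first by rewrite mem_imset // inE.
by rewrite (negPf NN) None_Some.
Qed.

Let clique_None j N : clique ext_adj j N -> None \in N -> N \subset h.
Proof.
move=> cN NN; apply: (clique_new eC' N_adj cN) => //.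
by rewrite SomeT finset.subsetT.
Qed.

Let new_inc a : a \in SA -> (a == a0) = false.
Proof. by move=> aS; apply: contraNF a0N => /eqP<-. Qed.

(** A clique containing [None] lies in the new hedron [h]. So it is [h] or, if
    it has k vertices, the face of [h] without some color i, which the neighbor
    of [a0] of color i labels. *)
Lemma partial_model_extend :
  partial_model (a0 |: SA) (SB :|: d.1 a0) ext_adj ext_hed ext_fr ext_color.
Proof.
have [[eC ei kV] [[hedI hedP frI frP] [pf dI dc]]] := mV.
have new b : b \in SB :|: d.1 a0 -> b \notin SB -> b \in d.1 a0.
  by rewrite !inE => /orP[->|].
split; first split; last (split; split).
- exact: eC'.
- by move=> [u|] /=.
- rewrite -SomeT; apply: (ktree_extend _ _ _ _ N_adj).
  + exact: (ktree_on_inj SI SE).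
  + by rewrite None_Some.
  + by apply: imsetS; apply: finset.subsetT.
  + exact/(clique_inj SI SE).
- move=> a a'; rewrite !inE /ext_hed => /orP[/eqP->|aS] /orP[/eqP->|aS'] //.
  + rewrite eqxx new_inc // => /setP/(_ None).
    by rewrite None_Some !inE.
  + rewrite eqxx new_inc // => /setP/(_ None).
    by rewrite None_Some !inE.
  by rewrite !new_inc // => /(imset_inj SI)/hedI; apply.
- move=> H; split=> [cH|[a + <-]]; last first.
    rewrite !inE /ext_hed => /orP[->|aS]; first exact: ch.
    by rewrite new_inc //; apply/(clique_inj SI SE)/hedP; exists a.
  have [NH|NH] := boolP (None \in H).
    exists a0; rewrite ?inE ?eqxx // /ext_hed eqxx; apply/esym/eqP.
    by rewrite eqEcard (clique_None cH NH) ch.1 cH.1 leqnn.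
  move: cH; rewrite (Some_cover NH) (clique_inj SI SE) => /hedP[a aS E].
  by exists a; rewrite ?inE ?aS ?orbT // /ext_hed new_inc // E.
- move=> b b' bU bU'; rewrite /ext_fr; case: ifPn => bS; case: ifPn => bS'.
  + by move=> /(imset_inj SI)/frI; apply.
  + move/setP/(_ None); rewrite None_Some None_face //; exact: new.
  + move/setP/(_ None); rewrite None_Some None_face //; exact: new.
  by move/face_inj; apply: (vd.2 a0).2; apply: new.
- move=> Q; split=> [cQ|[b bU <-]]; last first.
    rewrite /ext_fr; case: ifPn => bS; last exact: face_clique.
    by apply/(clique_inj SI SE)/frP; exists b.
  have [NQ|NQ] := boolP (None \in Q); last first.
    move: cQ; rewrite (Some_cover NQ) (clique_inj SI SE) => /frP[b bS E].
    by exists b; rewrite ?inE ?bS // /ext_fr bS E.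
  have [i iQ] : exists i, i \notin ext_color @: Q.
    by apply: missing_color; rewrite cQ.1 card_ord.
  have Qh := clique_None cQ NQ.
  have QE : Q = face i.
    apply/eqP; rewrite eqEcard face_card cQ.1 leqnn andbT.
    apply/fintype.subsetP=> u uQ; rewrite inE (fintype.subsetP Qh) //=.
    by apply: contraNneq iQ => <-; apply: imset_f.
  have [ba bi] := nbr_of_colorP b0 a0 i vd;
    set b := nbr_of_color _ _ _ _ in ba bi.
  have bS : b \notin SB.
    apply: contraNN iQ => /(b0u ba) E; rewrite -bi E.
    by apply/imsetP; exists None.
  by exists b; rewrite ?inE ?ba ?orbT // /ext_fr (negPf bS) bi QE.
- exact: pf'.
- have subS (P Q : {set V}) : (Some @: P \subset Some @: Q) = (P \subset Q).
    apply/idP/idP => [sub|]; last exact: imsetS.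
    apply/fintype.subsetP=> u uP; rewrite -(mem_imset _ _ SI).
    by apply: (fintype.subsetP sub); apply: imset_f.
  move=> a b; rewrite [a \in _]inE [a \in [set _]]inE /ext_hed /ext_fr.
  move=> /orP[/eqP->|aS] bU.
    rewrite eqxx; case: ifPn => bS; last first.
      rewrite new //; apply/esym/fintype.subsetP=> u; rewrite inE; by case/andP.
    have -> : (Some @: fr b \subset h) = (fr b \subset fr b0).
      rewrite -subS; apply/fintype.subsetP/fintype.subsetP => sub u ub.
        by have := sub u ub; case/imsetP: ub => v _ ->; rewrite !inE.
      by have := sub u ub; rewrite inE => ->; rewrite orbT.
    apply/idP/idP => [ba|sub]; first by rewrite (b0u ba bS).
    suff -> : b = b0 by [].
    apply: frI => //; apply/eqP; rewrite eqEcard sub cb0.1.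
    by have /frP[-> _] : exists2 b', b' \in SB & fr b' = fr b;
      [exists b | rewrite /=].
  rewrite new_inc //; case: ifPn => bS; first by rewrite subS dI.
  have -> : b \in d.1 a = false.
    by apply: contraNF bS; apply: (fintype.subsetP (closed aS)).
  apply/esym/negP=> /fintype.subsetP/(_ None); rewrite None_Some.
  by move=> /(_ (None_face (new _ bU bS) bS)).
move=> b bU; rewrite /ext_fr; case: ifPn => bS.
  apply: contra (dc b bS) => /imsetP[_ /imsetP[u ub ->] ->].
  exact: imset_f.
by apply/imsetP=> -[u]; rewrite inE => /andP[_ /eqP ne] E; apply: ne.
Qed.

End Extend.

Section Root.
Variable y0 : B.
Local Notation par := (parent (inc_adj d.1) (inr y0)).

(** The neighbors of [SA] and the root, when [SA] contains with a black vertex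
    all the black vertices above it. *)
Definition white_part (SA : {set A}) : {set B} :=
  [set b | (b == y0) || [exists a in SA, par (inr b) == Some (inl a)]].

Lemma white_partP (SA : {set A}) b :
  reflect (b = y0 \/ exists2 a, a \in SA & par (inr b) = Some (inl a))
          (b \in white_part SA).
Proof.
rewrite inE; apply: (iffP orP) => -[]; try by [left; apply/eqP].
- by move=> /exists_inP[a aS /eqP E]; right; exists a.
by move=> [a aS E]; right; apply/exists_inP; exists a; rewrite ?E.
Qed.

Lemma partial_model_base : exists (V : finType) (e : rel V)
    (hed : A -> {set V}) (fr : B -> {set V}) (f : V -> color),
  partial_model finset.set0 (white_part finset.set0) e hed fr f.
Proof.
have w0 b : (b \in white_part finset.set0) = (b == y0).
  by apply/white_partP/eqP => [[//|[a]]|]; [rewrite inE|left].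
exists 'I_k, (fun u v => u != v), (fun _ => finset.set0), (fun _ =>
  [set: 'I_k]),
  (lift (d.2 y0)); split; first split; last (split; split).
- by move=> u v; rewrite eq_sym.
- by move=> u; rewrite eqxx.
- by apply: ktree_complete; split=> //; rewrite cardsT card_ord.
- by move=> a; rewrite inE.
- move=> H; split=> [[cH _]|[a]]; last by rewrite inE.
  by have := max_card (mem H); rewrite cH card_ord ltnn.
- by move=> b b'; rewrite !w0 => /eqP-> /eqP->.
- move=> Q; split=> [[cQ _]|[b _ <-]]; last by split=> //;
  rewrite cardsT card_ord.
  exists y0; first by rewrite w0.
  by apply/esym/eqP; rewrite eqEcard finset.subsetT cardsT card_ord cQ leqnn.
- by move=> u v; apply: contra_neq => /lift_inj.
- by move=> a; rewrite inE.
move=> b; rewrite w0 => /eqP->; apply/imsetP=> -[u _ E].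
by have := neq_lift (d.2 y0) u; rewrite -E eqxx.
Qed.

(** Black vertices are added in the order of their height. The parent of the
    next one is then the only one of its neighbors already present. *)
Lemma partial_model_grow n : (n <= #|A|)%N -> exists SA : {set A},
  [/\ #|SA| = n, forall a, a \in SA -> d.1 a \subset white_part SA
    & exists (V : finType) (e : rel V) (hed : A -> {set V}) (fr : B -> {set V})
        (f : V -> color), partial_model SA (white_part SA) e hed fr f].
Proof.
have te := vd.1; have [h [hlt _]] := parent_height te (inr y0).
elim: n => [_|n IH lt].
  by exists finset.set0; rewrite cards0; split=> // [a|];
    [rewrite inE|exact: partial_model_base].
have [SA [cSA closed [V [e [hed [fr [f mV]]]]]]] := IH (ltnW lt).
have [a1 a1N] : exists a, a \notin SA.
  apply/existsP; rewrite -negb_forall; apply: contraL lt => /forallP all.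
  rewrite -leqNgt -cSA -cardsT; apply: subset_leq_card.
  by apply/fintype.subsetP=> a _; apply: all.
have [a0 a0N a0min] := @arg_minnP _ a1 (fun a => a \notin SA) (fun a =>
  h (inl a)) a1N.
have [b0 pa0] : exists b0, par (inl a0) = Some (inr b0).
  have [[a|b0] E] := parent_some te (r := inr y0) (v := inl a0) isT;
    last by exists b0.
  by have := parent_adj te E.
have b0a : b0 \in d.1 a0 := parent_adj te pa0.
have b0S : b0 \in white_part SA.
  apply/white_partP; have [->|ne] := eqVneq b0 y0; [by left|right].
  have [[a|b] E] := parent_some te (r := inr y0) (v := inr b0) ne;
    last by have := parent_adj te E.
  exists a => //; apply: contraT => /a0min; rewrite leqNgt.
  by rewrite (ltn_trans (hlt _ _ E) (hlt _ _ pa0)).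
have child b : b \in d.1 a0 -> b != b0 -> par (inr b) = Some (inl a0).
  move=> ba bb0; have /(parent_total te (inr y0))[//|] :
    inc_adj d.1 (inr b) (inl a0) by [].
  by rewrite pa0 => -[E]; rewrite E eqxx in bb0.
have b0u b : b \in d.1 a0 -> b \in white_part SA -> b = b0.
  move=> ba /white_partP bS; apply/eqP; apply: contraT => /(child b ba) pb.
  case: bS pb => [->|[a aS ->]]; first by rewrite (parent_root te).
  by move=> [E]; rewrite -E aS in a0N.
have wE : white_part (a0 |: SA) = white_part SA :|: d.1 a0.
  apply/setP=> b; rewrite finset.in_setU; apply/white_partP/orP.
    move=> [->|[a]]; first by left; apply/white_partP; left.
    rewrite in_setU1 => /orP[/eqP->|aS] E; first by right;
      have := parent_adj te E.
    by left; apply/white_partP; right; exists a.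
  move=> [/white_partP[->|[a aS E]]|ba]; first by left.
    by right; exists a; rewrite // in_setU1 aS orbT.
  have [E|/(child b ba) E] := eqVneq b b0; last by right; exists a0;
    rewrite ?setU11.
  move: b0S; rewrite -E => /white_partP[->|[a aS E']]; first by left.
  by right; exists a; rewrite // in_setU1 aS orbT.
exists (a0 |: SA); split.
- by rewrite cardsU1 a0N cSA.
- move=> a; rewrite wE in_setU1 => /orP[/eqP->|/closed sub];
  first exact: finset.subsetUr.
  by apply: (fintype.subset_trans sub); apply: finset.subsetUl.
rewrite wE; exists (option V), (ext_adj e fr b0), (ext_hed hed fr a0 b0),
  (ext_fr (white_part SA) fr f b0), (ext_color f b0).
exact: partial_model_extend.
Qed.

End Root.

Lemma represents_realize : exists t : labeled_graph A B, represents d t.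
Proof.
have te := vd.1; have [y0 _] : exists y0 : B, true.
  have [/card_gt0P[[a|b] _] _ _ _ _] := te; last by exists b.
  by have /card_gt0P[b _] : (0 < #|d.1 a|)%N; [rewrite (vd.2 a).1 | exists b].
have [SA [cSA closed [V [e [hed [fr [f mV]]]]]]] :=
  partial_model_grow y0 (leqnn _).
have SAT a : a \in SA.
  have /eqP -> : SA == [set: A] by rewrite eqEcard finset.subsetT cardsT cSA
    leqnn.
  by rewrite inE.
have SBT b : b \in white_part y0 SA.
  apply/white_partP; have [->|ne] := eqVneq b y0; [by left|right].
  have [[a|b'] E] := parent_some te (r := inr y0) (v := inr b) ne.
    by exists a.
  by have := parent_adj te E.
have [kV [[hedI hedP frI frP] [pf dI dc]]] := mV.
have m : ktree_model k e hed fr.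
  split=> //; split.
  - by move=> a a'; apply: hedI.
  - by move=> H; rewrite hedP; split=> -[a]; exists a.
  - by move=> b b'; apply: frI.
  by move=> Q; rewrite frP; split=> -[b]; exists b.
pose t := @LabeledGraph A B #|V| (fun x y => e (enum_val x) (enum_val y))
  [ffun a => enum_rank @: hed a] [ffun b => enum_rank @: fr b].
have gE u v : adj t (enum_rank u) (enum_rank v) = e u v
  by rewrite /= !enum_rankK.
have hE : (hedron t : A -> _) = fun a => enum_rank @: hed a.
  by apply/funext=> a; rewrite ffunE.
have fE : (front t : B -> _) = fun b => enum_rank @: fr b.
  by apply/funext=> b; rewrite ffunE.
exists t; split.
  change (ktree_model k (adj t) (hedron t) (front t)); rewrite hE fE.
  by apply: (ktree_model_bij enum_rank_inj gE) m; exists enum_val;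
    [exact: enum_rankK|exact: enum_valK].
exists (f \o enum_val); split; first by move=> x y /pf.
rewrite /encodes hE fE (incidence_inj (enum_rank_inj (T := V))); split=> [|b].
  apply/ffunP=> a; apply/setP=> b; rewrite incE dI //.
apply: contra (dc b (SBT b)) => /imsetP[_ /imsetP[v vb ->] ->].
by rewrite /= enum_rankK imset_f.
Qed.

End Growth.

(** * Counting fixed structures *)

Lemma card_fset_set_imset (U : choiceType) (T : finType) (P : {set T})
    (F : T -> U) (X : set U) : {in P &, injective F} ->
  (forall u, X u <-> exists2 t, t \in P & F t = u) -> #|` fset_set X| = #|P|.
Proof.
move=> FI XP; pose s := [seq F t | t <- enum P].
have -> : X = [set` [fset x in s]%fset]%classic.
  apply/seteqP; split=> u /=; rewrite inE.
    by move/XP=> [t tP <-]; apply: map_f; rewrite mem_enum.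
  by case/mapP=> t; rewrite mem_enum => tP ->; apply/XP; exists t.
rewrite set_fsetK card_fseq undup_id ?size_map -?cardE //.
by rewrite map_inj_in_uniq ?enum_uniq // => x y; rewrite !mem_enum; apply: FI.
Qed.

Lemma card_sum_fibre (S T : finType) (D : {set S}) (Q : S -> {set T}) :
  #|[set p : S * T | (p.1 \in D) && (p.2 \in Q p.1)]|
    = (\sum_(d in D) #|Q d|)%N.
Proof.
rewrite -sum1dep_card -(pair_big_dep (fun x => x \in D) (fun x y =>
  y \in Q x) (fun _ _ => 1%N)) /=.
by apply: eq_bigr => d _; rewrite sum1_card.
Qed.

Lemma card_partition_fun (S I : finType) (P : {set S}) (f : S -> I) :
  (\sum_i #|[set x in P | f x == i]| = #|P|)%N.
Proof.
rewrite -[RHS]sum1_card (partition_big f predT) //=.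
by apply: eq_bigr => i _; rewrite -sum1dep_card.
Qed.

(** Burnside's lemma for the map induced by [f] on the orbits: in an orbit that
    [f] preserves, the elements [g] taking [f x] to [x] form a coset of a
    stabilizer. *)
Lemma burnside_twisted (G : finGroupType) (T : finType) (to : {action G &-> T})
    (D : {set T}) (f : T -> T) : (forall x g, x \in D -> to x g \in D) ->
  (forall x y, y \in orbit to [set: G] x ->
     f y \in orbit to [set: G] (f x)) ->
  (\sum_(g : G) #|[set x in D | to (f x) g == x]| =
   #|G| * #|orbit to [set: G] @: [set x in D | f x \in orbit to [set: G] x]|)%N.
Proof.
move=> Dto forb; set D' := [set x in D | _].
pose R := [set: G]%G.
have amoveE x : x \in D -> #|[set g : G | to (f x) g == x]| =
    if x \in D' then (#|G| %/ #|orbit to R x|)%N else 0%N.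
  move=> xD; rewrite inE xD /=; case: ifPn => [fx|nfx].
    have /orbitP[g _ fg] : x \in orbit to R (f x) by rewrite orbit_sym.
    have E : orbit to R (f x) = orbit to R x by apply/orbit_eqP.
    have := card_orbit_stab to R (f x); rewrite E cardsT => <-.
    rewrite mulKn; last by apply/card_gt0P; exists x; apply: orbit_refl.
    rewrite -[RHS](card_rcoset _ g).
    have <- : amove to R (f x) (to (f x) g) = ('C_R[f x | to] :* g)%g.
      by apply: amove_act; rewrite ?inE ?finset.subsetT.
    by congr #|pred_of_set _|; apply/setP=> z; rewrite !inE fg.
  apply/eqP; rewrite cards_eq0; apply/eqP/setP=> g; rewrite !inE.
  apply: contraNF nfx => /eqP gx; rewrite orbit_sym; apply/orbitP.
  by exists g; rewrite ?inE.
have -> : (\sum_(g : G) #|[set x in D | to (f x) g == x]| =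
    \sum_(x in D') #|G| %/ #|orbit to R x|)%N.
  rewrite (eq_bigr (fun g => \sum_(x | (x \in D) && (to (f x) g == x)) 1))%N;
    last first.
    by move=> g _; rewrite sum1dep_card.
  rewrite (exchange_big_dep (fun x => x \in D)) /=;
    last by move=> g x _ /andP[].
  rewrite (eq_bigr (fun x => #|[set g : G | to (f x) g == x]|)); last first.
    by move=> x xD; rewrite -sum1dep_card; apply: eq_bigl => g; rewrite xD.
  rewrite (bigID (fun x => x \in D')) /= [X in (_ + X)%N]big1 ?addn0;
    last first.
    by move=> x /andP[xD /negPf xN]; rewrite amoveE // xN.
  rewrite (eq_bigl (fun x => x \in D')); last first.
    by move=> x; rewrite [in RHS]inE inE; case: (x \in D).
  by apply: eq_bigr => x xD'; rewrite amoveE ?xD' //; move: xD';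
    rewrite inE => /andP[].
have acts : [acts R, on D' | to].
  apply/actsP=> g _ x.
  have Dg y h : y \in D' -> to y h \in D'.
    rewrite !inE => /andP[yD fy]; rewrite Dto //=.
    have oy : to y h \in orbit to R y by apply/orbitP; exists h; rewrite ?inE.
    rewrite (_ : orbit to _ (to y h) = orbit to [set: G] y);
      last exact/orbit_eqP.
    by apply: orbit_trans fy; apply: forb.
  by apply/idP/idP => [/(Dg _ g^-1%g)|/Dg //]; rewrite actK.
rewrite (set_partition_big _ (orbit_partition acts)) /=.
rewrite (eq_bigr (fun _ => #|G|)) ?sum_nat_const 1?mulnC //.
move=> _ /imsetP[x xD' ->].
rewrite (eq_bigr (fun _ => #|G| %/ #|orbit to R x|)%N); last first.
  by move=> y oy; rewrite (_ : orbit to R y = orbit to R x) //; apply/orbit_eqP.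
by rewrite sum_nat_const mulnC divnK // -[#|G|]cardsT dvdn_orbit.
Qed.

Section FixedStructures.
Variables (k : nat) (A B : finType) (mu : {perm A}) (nu : {perm B}).
Hypothesis k0 : (0 < k)%N.
Local Notation color := 'I_k.+1.
Local Notation colored_tree := (colored_tree k A B).
Implicit Types (d : colored_tree) (s t : 'S_k.+1).

Lemma recolor1 d : recolor 1%g d = d.
Proof. by case: d => I c; congr pair; apply/ffunP=> b; rewrite ffunE perm1. Qed.

Lemma recolorM d s t : recolor (s * t)%g d = recolor t (recolor s d).
Proof. by congr pair; apply/ffunP=> b; rewrite !ffunE permM. Qed.

Lemma recolor_relabel_tree d s :
  recolor s (relabel_tree mu nu d) = relabel_tree mu nu (recolor s d).
Proof. by congr pair; apply/ffunP=> b; rewrite !ffunE. Qed.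

Definition valid_trees : {set colored_tree} := [set d | `[< valid d >]].

Lemma valid_treesP d : reflect (valid d) (d \in valid_trees).
Proof. by rewrite inE; apply: asboolP. Qed.

Definition fixed_trees s : {set colored_tree} :=
  [set d in valid_trees | recolor s (relabel_tree mu nu d) == d].

Lemma fixed_treesP s d :
  reflect (valid d /\ recolor s (relabel_tree mu nu d)
    = d) (d \in fixed_trees s).
Proof.
by rewrite inE; apply: (iffP andP) => -[/valid_treesP vd /eqP].
Qed.

Lemma fixed_inc s d a b : d \in fixed_trees s ->
  (nu b \in d.1 (mu a)) = (b \in d.1 a).
Proof. by move=> /fixed_treesP[_ E]; rewrite -{1}E relabel_tree_inc. Qed.

Lemma fixed_col s d b : d \in fixed_trees s -> d.2 (nu b) = s (d.2 b).
Proof. by move=> /fixed_treesP[_ E]; rewrite -{1}E ffunE relabel_tree_col. Qed.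

(** In a structure of CT^XY over the colored tree [d] the white end of the root
    edge is the neighbor of color 0 of the black one, and need not be fixed by
    [nu]. *)
Definition pointed d : {set A * B} :=
  [set p | [&& mu p.1 == p.1, p.2 \in d.1 p.1 & d.2 p.2 == 0]].

(** The root edge fixes the coloring by giving color 0 to its white end. *)
Lemma card_fixed_CTXY s :
  #|` fset_set (fixed (CTXY k) s mu nu)|
    = (\sum_(d in fixed_trees s) #|pointed d|)%N.
Proof.
rewrite -card_sum_fibre.
apply: (card_fset_set_imset (F := fun p => (p.2, coding_of p.1))).
  move=> [d [x y]] [d' [x' y']]; rewrite inE => /andP[/fixed_treesP[vd _]].
  rewrite inE => /and3P[_ _ /eqP/= yc];
    rewrite inE => /andP[/fixed_treesP[vd' _]].
  rewrite inE => /and3P[_ _ /eqP/= yc'] [<- Ey Ec]; rewrite -Ey in yc' *;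
    congr pair.
  by apply: (coding_of_inj k0 (y := y) vd vd' Ec); rewrite yc.
move=> [[x y] c]; split.
  move=> [[/= ct xy] [mx ny ec]].
  have [d vd [dc dy]] := coding_of_surj k0 y ct.
  have vr := valid_relabel_tree mu nu vd.
  have ry : (relabel_tree mu nu d).2 (nu y) = 0 by rewrite relabel_tree_col.
  have xy' : y \in d.1 x by rewrite -(coding_of_moves k0 _ _ vd) dc.
  have rxy : nu y \in (relabel_tree mu nu d).1 (mu x)
    by rewrite relabel_tree_inc.
  have rE : relabel_coding mu nu c = coding_of (relabel_tree mu nu d)
    by rewrite -dc relabel_coding_of.
  rewrite rE in ny ec.
  have := @act_coding_of k A B k0 (inl (mu x)) (nu y)
    (relabel_tree mu nu d) s vr ry rxy.
  rewrite ec => ec'.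
  have [yi yc] := @new_nbrP k A B k0 (inl (mu x)) (nu y)
    (relabel_tree mu nu d) s vr ry rxy (mu x) 0.
  rewrite ny eqxx addr0 in yi yc.
  exists (d, (x, y)) => /=; last by rewrite dc.
  rewrite inE; apply/andP; split; last by rewrite inE /= mx xy' dy !eqxx.
  apply/fixed_treesP; split=> //; apply: (coding_of_inj k0 (y := y)) => //;
    first exact: valid_recolor.
    by rewrite -ec' dc.
  by rewrite ffunE yc dy.
move=> [[d [x' y']]]; rewrite inE /= => /andP[df];
  rewrite inE /= => /and3P[/eqP mx xy /eqP dy].
case=> <- <- <- {x y c}; have [vd dE] := fixed_treesP _ _ df.
split=> /=.
  by split; [apply: coding_tree_coding_of | rewrite coding_of_moves].
have vr := valid_relabel_tree mu nu vd.
have ry : (relabel_tree mu nu d).2 (nu y') = 0 by rewrite relabel_tree_col.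
have rxy : nu y' \in (relabel_tree mu nu d).1 (mu x')
  by rewrite relabel_tree_inc.
rewrite relabel_coding_of // (@act_coding_of k A B k0 (inl (mu x')) (nu y')
  (relabel_tree mu nu d) s vr ry rxy) dE.
have [yi yc] := @new_nbrP k A B k0 (inl (mu x')) (nu y')
  (relabel_tree mu nu d) s vr ry rxy (mu x') 0.
rewrite eqxx addr0 in yc; congr (_, _, _) => //.
have dI : d.1 = (relabel_tree mu nu d).1 by rewrite -{1}dE.
move: (new_nbr _ _ _ _ _ _) yi yc => z zi zc; rewrite mx -dI in zi.
by apply: (vd.2 x').2; rewrite // dy -{1}dE ffunE.
Qed.

Lemma card_pointed d : valid d -> #|pointed d| = #|[set a | mu a == a]|.
Proof.
move=> vd; rewrite -(card_in_imset (f := fst) (D := pointed d)).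
  congr #|pred_of_set _|; apply/setP=> a; rewrite inE; apply/imsetP/idP.
    by move=> [[a' b]]; rewrite inE => /and3P[ma _ _] ->.
  move=> ma; have /card_gt0P[b _] : (0 < #|d.1 a|)%N by rewrite (vd.2 a).1.
  exists (a, nbr_of_color b d a 0) => //;
    rewrite inE /= ma nbr_of_color_inc // nbr_of_color_col //.
move=> [a b] [a' b']; rewrite !inE /= =>
  /and3P[_ ib /eqP cb] /and3P[_ ib' /eqP cb'] E.
rewrite -E in ib' *; congr pair; apply: (vd.2 a).2 => //; by rewrite cb.
Qed.

Definition fixed_edges d i : {set A * B} :=
  [set p | [&& mu p.1 == p.1, nu p.2 == p.2, p.2 \in d.1 p.1 & d.2 p.2 == i]].

Definition fixed_whites d i : {set B} := [set b | (nu b == b) && (d.2 b == i)].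

(** If [s] fixes 0, the neighbor of color 0 of a fixed black vertex is too. *)
Lemma pointed_fixed_edges s d : s 0 = 0 -> d \in fixed_trees s ->
  pointed d = fixed_edges d 0.
Proof.
move=> s0 df; apply/setP=> -[a b]; rewrite !inE /=.
case: eqP => //= ma; case: (boolP (b \in d.1 a)) => ib; rewrite ?andbF //=.
case: (d.2 b =P 0) => cb; rewrite ?andbF //= andbT; symmetry; apply/eqP.
have [vd _] := fixed_treesP _ _ df.
apply: (vd.2 a).2 => //; first by rewrite -{1}ma (fixed_inc _ _ df).
by rewrite (fixed_col _ df) cb.
Qed.

Lemma card_fixed_CTY (s : [subg Sk k]) :
  #|` fset_set (fixed (CTY k) s mu nu)| =
  (\sum_(d in fixed_trees (sgval s)) #|fixed_whites d 0%R|)%N.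
Proof.
have s0 : sgval s 0 = 0 by have /astab1P := subgP s.
rewrite -card_sum_fibre.
apply: (card_fset_set_imset (F := fun p => (p.2, coding_of p.1))).
  move=> [d y] [d' y']; rewrite inE => /andP[/fixed_treesP[vd _]].
  rewrite inE => /andP[_ /eqP/= yc]; rewrite inE => /andP[/fixed_treesP[vd' _]].
  rewrite inE => /andP[_ /eqP/= yc'] [Ey Ec]; rewrite -Ey in yc' *; congr pair.
  by apply: (coding_of_inj k0 (y := y) vd vd' Ec); rewrite yc.
move=> [y c]; split.
  move=> [/= ct [ny ec]].
  have [d vd [dc dy]] := coding_of_surj k0 y ct.
  have vr := valid_relabel_tree mu nu vd.
  have ry : (relabel_tree mu nu d).2 (nu y) = 0 by rewrite relabel_tree_col.
  have rE : relabel_coding mu nu c = coding_of (relabel_tree mu nu d)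
    by rewrite -dc relabel_coding_of.
  rewrite rE in ec.
  have := @act_coding_of k A B k0 (inr (nu y)) (nu y) (relabel_tree mu nu d)
    (sgval s) vr ry (conj erefl s0).
  rewrite ec => ec'.
  exists (d, y) => /=; last by rewrite dc.
  rewrite inE; apply/andP; split; last by rewrite inE /= ny dy !eqxx.
  apply/fixed_treesP; split=> //; apply: (coding_of_inj k0 (y := y)) => //;
    first exact: valid_recolor.
    by rewrite -ec' dc.
  by rewrite ffunE dy -[X in (relabel_tree _ _ _).2 X]ny relabel_tree_col dy.
move=> [[d y']]; rewrite inE /= => /andP[df];
  rewrite inE => /andP[/eqP ny /eqP dy].
case=> <- <- {y c}; have [vd dE] := fixed_treesP _ _ df.
split=> /=; first exact: coding_tree_coding_of.
have vr := valid_relabel_tree mu nu vd.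
have ry : (relabel_tree mu nu d).2 (nu y') = 0 by rewrite relabel_tree_col.
by rewrite relabel_coding_of // (@act_coding_of k A B k0 (inr (nu y')) (nu y')
  (relabel_tree mu nu d) (sgval s) vr ry (conj erefl s0)) dE ny.
Qed.

End FixedStructures.

Section Counting.
Variables (k : nat) (A B : finType) (mu : {perm A}) (nu : {perm B}).
Hypothesis k0 : (0 < k)%N.
Local Notation color := 'I_k.+1.
Local Notation colored_tree := (colored_tree k A B).
Local Notation fixed_trees := (@fixed_trees k A B mu nu).
Implicit Types (d : colored_tree) (s t : 'S_k.+1).

Lemma fixed_treesJ s t d :
  (recolor t d \in fixed_trees (s ^ t)%g) = (d \in fixed_trees s).
Proof.
apply/fixed_treesP/fixed_treesP => -[vd E]; last first.
  split; first exact: valid_recolor.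
  by rewrite -recolor_relabel_tree -recolorM conjgE mulKVg recolorM E.
have td : d = recolor t^-1 (recolor t d) by rewrite -recolorM mulgV recolor1.
split; first by rewrite td; apply: valid_recolor.
rewrite -recolor_relabel_tree -recolorM conjgE mulKVg recolorM in E.
by rewrite [RHS]td -E -recolorM mulgV recolor1.
Qed.

(** Only permutations fixing the color i contribute to the term of i, and
    conjugation by a transposition makes all these terms equal to that of 0. *)
Lemma sum_color_stabilizer (w : colored_tree -> color -> nat) :
  (forall t d i, w (recolor t d) (t i) = w d i) ->
  (forall s d i, d \in fixed_trees s -> s i != i -> w d i = 0%N) ->
  ((\sum_(s in Sk k) \sum_(d in fixed_trees s) w d 0%R) * k.+1 =
   \sum_(s : 'S_k.+1) \sum_(d in fixed_trees s) \sum_i w d i)%N.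
Proof.
move=> wJ w0; have -> : (\sum_(s in Sk k) \sum_(d in fixed_trees s) w d 0%R =
    \sum_(s : 'S_k.+1) \sum_(d in fixed_trees s) w d 0%R)%N.
  rewrite [RHS](bigID (fun s => s \in Sk k)) /= [X in
    (_ + X)%N]big1 ?addn0 // => s sN.
  apply: big1 => d df; apply: w0 df _; apply: contra sN => /eqP s0.
  exact/astab1P.
under [RHS]eq_bigr do rewrite exchange_big; rewrite [RHS]exchange_big /=.
rewrite mulnC; set S := (\sum_s _)%N.
rewrite [RHS](eq_bigr (fun _ => S)); first by rewrite sum_nat_const card_ord.
move=> i _; symmetry; rewrite /S.
pose t : 'S_k.+1 := tperm 0 i; have t0 : t 0 = i by rewrite tpermL.
rewrite [RHS](reindex_inj (conjg_inj t)); apply: eq_bigr => s _.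
have tI : injective (recolor (A := A) (B := B) t).
  by move=> d d' E; rewrite -(recolor1 d) -(recolor1 d') -(mulgV t) !recolorM E.
rewrite [RHS](reindex_inj tI) /=; apply: eq_big => d;
  first by rewrite fixed_treesJ.
by rewrite -(wJ t d 0) t0.
Qed.

Lemma sum_fixed_whites :
  ((\sum_(s in Sk k) \sum_(d in fixed_trees s) #|fixed_whites nu d 0%R|) * k.+1
    =
   \sum_(s : 'S_k.+1) \sum_(d in fixed_trees s) #|[set b | nu b == b]|)%N.
Proof.
rewrite (sum_color_stabilizer (w := fun d i => #|fixed_whites nu d i|)).
- apply: eq_bigr => s _; apply: eq_bigr => d _.
  rewrite -(card_partition_fun _ d.2); apply: eq_bigr => i _.
  by congr #|pred_of_set _|; apply/setP=> b; rewrite !inE.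
- move=> t d i; congr #|pred_of_set _|; apply/setP=> b.
  by rewrite !inE ffunE (inj_eq perm_inj).
move=> s d i df si; apply/eqP; rewrite cards_eq0; apply/eqP/setP=> b.
rewrite !inE; apply: contraNF si => /andP[/eqP nub /eqP <-].
by rewrite -(fixed_col _ df) nub.
Qed.

Lemma sum_fixed_edges :
  ((\sum_(s in Sk k) \sum_(d in fixed_trees s) #|fixed_edges mu nu d 0%R|) *
    k.+1 =
   \sum_(s : 'S_k.+1) \sum_(d in fixed_trees s)
     #|[set p : A * B | [&& mu p.1 == p.1, nu p.2 == p.2 & p.2 \in d.1
       p.1]]|)%N.
Proof.
rewrite (sum_color_stabilizer (w := fun d i => #|fixed_edges mu nu d i|)).
- apply: eq_bigr => s _; apply: eq_bigr => d _.
  rewrite -(card_partition_fun _ (fun p => d.2 p.2)); apply: eq_bigr => i _.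
  by congr #|pred_of_set _|; apply/setP=> p; rewrite !inE -!andbA.
- move=> t d i; congr #|pred_of_set _|; apply/setP=> p.
  by rewrite !inE ffunE (inj_eq perm_inj).
move=> s d i df si; apply/eqP; rewrite cards_eq0; apply/eqP/setP=> p.
rewrite !inE; apply: contraNF si => /and4P[_ /eqP nub _ /eqP <-].
by rewrite -(fixed_col _ df) nub.
Qed.

Lemma fixed_tree_dissymmetry s d : d \in fixed_trees s ->
  (#|[set a | mu a == a]| + #|[set b | nu b == b]| =
   #|[set p : A * B | [&& mu p.1 == p.1, nu p.2 == p.2 & p.2 \in d.1 p.1]]| +
     1)%N.
Proof.
move=> df; have [[td _] _] := fixed_treesP _ _ _ _ df.
apply: (tree_dissymmetry td (@inc_bip _ _ _)) => -[a|b] [a'|b'] //=;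
  exact: fixed_inc df.
Qed.

(** For every permutation and every colored tree fixed with it, this is the
    dissymmetry formula of the tree. *)
Lemma sum_dissymmetry :
  (\sum_(s : 'S_k.+1) #|` fset_set (fixed (CTXY k) s mu nu)|
   + k.+1 * \sum_(s : [subg Sk k]) #|` fset_set (fixed (CTY k) s mu nu)|
   = \sum_(s : 'S_k.+1) #|fixed_trees s|
   + k.+1 * \sum_(s : [subg Sk k])
       #|` fset_set (fixed (restrict_gspecies (Sk k) (CTXY k)) s mu nu)|)%N.
Proof.
have sub (F : 'S_k.+1 -> nat) :
    (\sum_(s : [subg Sk k]) F (sgval s) = \sum_(s in Sk k) F s)%N.
  rewrite [RHS](reindex_onto (@sgval _ (Sk k)) (subg (Sk k))) => [|s sS];
    last exact: subgK.
  by apply: eq_bigl => s; rewrite subgP sgvalK eqxx.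
rewrite (eq_bigr _ (fun s _ => card_fixed_CTXY mu nu k0 s)).
rewrite [X in (_ + _ * X = _)%N](eq_bigr _ (fun (s : [subg Sk k]) _ =>
  card_fixed_CTY mu nu k0 s)).
rewrite [X in (_ = _ + _ * X)%N](eq_bigr (fun s : [subg Sk k] =>
  \sum_(d in fixed_trees (sgval s)) #|fixed_edges mu nu d 0%R|)%N); last first.
  move=> s _; rewrite [LHS](card_fixed_CTXY mu nu k0 (sgval s)).
  have s0 : sgval s 0 = 0 by have /astab1P := subgP s.
  by apply: eq_bigr => d df; rewrite (pointed_fixed_edges s0 df).
rewrite !(sub (fun s => \sum_(d in fixed_trees s) _)%N) ![(k.+1 * _)%N]mulnC.
rewrite sum_fixed_whites sum_fixed_edges -!big_split /=.
apply: eq_bigr => s _; rewrite -[#|fixed_trees s|]sum1_card -!big_split /=;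
  apply: eq_bigr => d df.
have [vd _] := fixed_treesP _ _ _ _ df.
by rewrite card_pointed // (fixed_tree_dissymmetry df) addnC.
Qed.

(** ** Orbits of colored trees are k-trees *)

Lemma relabel_treeK d : relabel_tree mu^-1 nu^-1 (relabel_tree mu nu d) = d.
Proof.
case: d => I c; congr pair; last by apply/ffunP=> b; rewrite !ffunE invgK permK.
apply/ffunP=> a; rewrite !ffunE invgK permK -imset_comp -[RHS]imset_id.
by apply: eq_imset => b; rewrite /= permK.
Qed.

Fact recolor_is_action : is_action [set: 'S_k.+1] (fun d s => recolor s d).
Proof.
split=> [s d d' E|d s t _ _]; last exact: recolorM.
by rewrite -(recolor1 d) -(recolor1 d') -(mulgV s) !recolorM E.
Qed.

Canonical recolor_action := Action recolor_is_action.

Lemma recolor_orbitP d d' :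
  reflect (exists s, d' = recolor s d) (d' \in orbit recolor_action [set:
    'S_k.+1] d).
Proof.
by apply: (iffP orbitP) => [[s _ <-]|[s ->]]; exists s; rewrite ?inE.
Qed.

(** The colored trees of a k-tree form one orbit under recoloring, and
    relabeling fixes the k-tree exactly when it preserves the orbit. *)
Lemma card_fixed_ktree :
  (\sum_(s : 'S_k.+1) #|fixed_trees s| = (k.+1)`! *
   #|` fset_set (fixed (trivial_gspecies 'S_1 (ktree_species k)) 1%g mu nu)|)%N.
Proof.
have := @burnside_twisted _ _ recolor_action (valid_trees k A B)
  (relabel_tree mu nu).
have -> : (#|{perm color}| = (k.+1)`!)%N by exact: card_Sn.
set O := orbit _ _ @: _.
move=> -> //; first last.
- move=> d d' /recolor_orbitP[s ->]; apply/recolor_orbitP; exists s.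
  by rewrite recolor_relabel_tree.
- by move=> d s /valid_treesP vd; apply/valid_treesP;
  apply: (valid_recolor s vd).
congr (_ * _)%N; symmetry.
pose Phi (o : {set colored_tree}) : set (labeled_graph A B) :=
  [set u | exists2 d, d \in o & represents d u]%classic.
have PhiE d u : Phi (orbit recolor_action [set:
  'S_k.+1] d) u <-> represents d u.
  split=> [[d' /recolor_orbitP[s ->]]|du]; last by exists d;
    rewrite ?orbit_refl.
  by move=> /(represents_recolor s^-1%g); rewrite -recolorM mulgV recolor1.
apply: (card_fset_set_imset (F := Phi)).
  move=> _ _ /imsetP[d + ->] /imsetP[d' + ->] E.
  rewrite inE => /andP[/valid_treesP vd _] _.
  have [t dt] := represents_realize vd.
  have d't : represents d' t by apply/PhiE; rewrite -E; apply/PhiE.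
  by apply/orbit_eqP/recolor_orbitP; apply: represents_uniq d't dt.
move=> C; split.
  move=> [[t kt CE] /= fC]; have [d dt] := represents_exists kt.
  have Cd u : C u <-> represents d u.
    rewrite CE; split=> [|du]; first exact: represents_iso dt.
    exact: represents_same_iso k0 _ _ dt du.
  exists (orbit recolor_action [set: 'S_k.+1] d); last first.
    by apply/seteqP; split=> u /=; [move/PhiE/Cd|move/Cd/PhiE].
  apply/imset_f; rewrite inE; apply/andP; split.
    by apply/valid_treesP; apply: represents_valid dt.
  apply/recolor_orbitP; apply: (represents_uniq (t := relabel_graph mu nu t)).
    by apply/Cd; rewrite -fC; exists t => //; apply/Cd.
  exact: represents_relabel.
move=> [_ /imsetP[d + ->] <-]; rewrite inE =>
  /andP[/valid_treesP vd /recolor_orbitP[s rs]].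
have [t dt] := represents_realize vd.
split.
  exists t; first by case: dt.
  apply/seteqP; split=> u /=; first by move/PhiE; apply: represents_same_iso.
  by move=> tu; apply/PhiE; apply: represents_iso tu.
apply/seteqP; split=> u /=.
  move=> [v /PhiE dv <-]; apply/PhiE.
  by have := represents_relabel mu nu dv;
    rewrite rs => /(represents_recolor s^-1%g);
    rewrite -recolorM mulgV recolor1.
move=> /PhiE du; exists (relabel_graph mu^-1 nu^-1 u).
  apply/PhiE; have := represents_relabel mu^-1 nu^-1 du.
  have -> : relabel_tree mu^-1 nu^-1 d = recolor s^-1 d.
    have E : d = relabel_tree mu nu (recolor s^-1 d).
      by rewrite -recolor_relabel_tree rs -recolorM mulgV recolor1.
    by rewrite {1}E relabel_treeK.
  by move/(represents_recolor s); rewrite -recolorM mulVg recolor1.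
case: u du => n e h r _; congr LabeledGraph; apply/ffunP=> x;
  by rewrite !ffunE invgK permKV.
Qed.

End Counting.

(** * Cycle indices *)

Lemma sum_cycle_index (I : finType) (Gamma : finGroupType) (F : gspecies Gamma)
    (g : I -> Gamma) (a b : monomial) :
  let m := mweight a in let n := mweight b in
  \sum_i cycle_index F (g i) a b = ((m`!)%:R * (n`!)%:R)^-1 *
    \sum_(mu : 'S_m) \sum_(nu : 'S_n)
      (\sum_i #|` fset_set (fixed F (g i) mu nu)|)%:R
      * ((cycle_type mu == a) && (cycle_type nu == b))%:R.
Proof.
rewrite /cycle_index /cycle_index_term -mulr_sumr; congr (_ * _).
rewrite exchange_big /=; apply: eq_bigr => mu _.
rewrite exchange_big /=; apply: eq_bigr => nu _.
by rewrite natr_sum mulr_suml.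
Qed.

Lemma solve_count (K f N X Y Z : nat) : (0 < K)%N -> (0 < f)%N ->
  (X + K * Y = K * f * N + K * Z)%N ->
  N%:R = (K * f)%:R^-1 * X%:R + f%:R^-1 * Y%:R - f%:R^-1 * Z%:R :> rat.
Proof.
move=> K0 f0 /(congr1 (fun n => n%:R : rat)); rewrite !natrD !natrM => E.
have nz n : (0 < n)%N -> n%:R != 0 :> rat by rewrite Num.Theory.pnatr_eq0 lt0n.
apply: (mulfI (mulf_neq0 (nz K K0) (nz f f0))).
rewrite mulrBr mulrDr !(mulrA (_ * _)) mulfV ?mulf_neq0 ?nz // mul1r.
by rewrite mulfK ?nz // E addrK.
Qed.

Lemma card_fixed_ktree_dissymmetry (k : nat) (A B : finType) (mu : {perm A})
    (nu : {perm B}) : (0 < k)%N ->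
  let count (Gamma : finGroupType) (F : gspecies Gamma) (g : Gamma) :=
    #|` fset_set (fixed F g mu nu)| in
  (count _ (trivial_gspecies 'S_1 (ktree_species k)) 1%g)%:R =
    ((k.+1)`!)%:R^-1 * (\sum_(s : 'S_k.+1) count _ (CTXY k) s)%:R
  + (k`!)%:R^-1 * (\sum_(s : [subg Sk k]) count _ (CTY k) s)%:R
  - (k`!)%:R^-1 * (\sum_(s : [subg Sk k])
                     count _ (restrict_gspecies (Sk k) (CTXY k)) s)%:R :> rat.
Proof.
move=> k0 /=; rewrite factS; apply: solve_count; rewrite ?fact_gt0 //.
by rewrite sum_dissymmetry // card_fixed_ktree // factS.
Qed.

(* Equality of two power series, coefficient by coefficient. *)
Theorem theorem5p10 (k : nat) (hk : (1 <= k)%N) (a b : monomial) :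
  ordinary_cycle_index (ktree_species k) a b =
    ((k.+1)`!)%:R^-1 * (\sum_(s : 'S_k.+1) cycle_index (CTXY k) s a b)
  + (k`!)%:R^-1 * (\sum_(s : [subg Sk k]) cycle_index (CTY k) s a b)
  - (k`!)%:R^-1 * (\sum_(s : [subg Sk k])
                     cycle_index (restrict_gspecies (Sk k) (CTXY k)) s a b).
Proof.
rewrite (sum_cycle_index (CTXY k) id) (sum_cycle_index (CTY k) id).
rewrite (sum_cycle_index (restrict_gspecies (Sk k) (CTXY k)) id).
have /= := fun mu nu =>
  @card_fixed_ktree_dissymmetry k 'I_(mweight a) 'I_(mweight b) mu nu hk.
rewrite /ordinary_cycle_index /cycle_index /cycle_index_term.
move: ((k.+1)`!)%:R^-1 (k`!)%:R^-1 (_ * _)^-1 => r1 r2 r key.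
rewrite ![_ * (r * _)]mulrCA -mulrDr -mulrBr; congr (r * _).
rewrite !mulr_sumr -big_split -sumrB /=; apply: eq_bigr => mu _.
rewrite !mulr_sumr -big_split -sumrB /=; apply: eq_bigr => nu _.
by rewrite key mulrBl mulrDl !mulrA.
Qed.
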